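(* Let $\theta$ be $\varepsilon_1$-close (in the $P$-norm) to $\mathcal{S}$, where $\varepsilon_1 = \frac{1}{2\sqrt{\|\Sigma\|_{\mathrm{op}}}}\left(\frac{1}{16}-\sqrt{\sigma_1(M\Sigma^{1/2})}\right)$. The training loss satisfies $$\left\|\mathbb{E}[\nabla\hat L(\theta)] - \nabla L(\theta)\right\|_F^2 \lesssim n^{-2}\log^6 n.$$
   Context: Covariates $x_i\in\mathbb{R}^d$ i.i.d. $\mathcal{N}(0,\Sigma)$, $y_i=Mx_i+z_i$ with $z_i$ i.i.d. $\mathcal{N}(0,\Omega)$ independent of covariates; $\theta=(A,B)$, $A\in\mathbb{R}^{p\times d}$, $B\in\mathbb{R}^{d\times d}$. Assumptions: $\Sigma$ full rank, $p\ge d$, $M\Sigma^{1/2}$ full column rank, $\|M\Sigma^{1/2}\|_{\mathrm{op}}<1/16$. $\hat L(\theta)=\frac{1}{2n}\sum_i\left\|A\frac{\sum_j\exp(x_i^{\top}Bx_j)x_j}{\sum_j\exp(x_i^{\top}Bx_j)}-y_i\right\|_2^2$; $L(\theta)=\frac12\mathbb{E}\left\|A\frac{\mathbb{E}_{x_2}[\exp(x_1^{\top}Bx_2)x_2]}{\mathbb{E}_{x_2}[\exp(x_1^{\top}Bx_2)]}-(Mx_1+z_1)\right\|_2^2$; the expectation of $\nabla\hat L$ is over the $n$ samples at fixed $\theta$. $\mathcal{S}=\{(U\Gamma^{1/2}J^{\top}\Sigma^{-1/2};\ \Sigma^{-1/2}V\Gamma^{1/2}J^{\top}\Sigma^{-1/2}):J\in\mathbb{O}_d\}$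 with $U\Gamma V^{\top}$ an SVD of $M\Sigma^{1/2}$; $P=\mathrm{diag}(I_p,\Sigma)$, $\|\theta\|_P=\sqrt{\mathrm{Tr}(\theta^{\top}P\theta)}$. $f(n)\lesssim g(n)$ means $f(n)\le Cg(n)$ for all sufficiently large $n$, with $C$ a constant polynomial in $p,d,\|M\|_{\mathrm{op}},\|\Sigma\|_{\mathrm{op}}$. *)

(* Defs.v *)
From HB Require Import structures.
From mathcomp Require Import all_boot all_order all_algebra.
From mathcomp Require Import all_classical all_reals all_analysis.
Set Implicit Arguments. Unset Strict Implicit. Unset Printing Implicit Defensive.
Import Order.TTheory GRing.Theory Num.Theory.
Import numFieldNormedType.Exports.
Local Open Scope classical_set_scope.
Local Open Scope ring_scope.

Definition gauss_pdf {R : realType} (t : R) : R :=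
  expR (- (t ^+ 2) / 2) / Num.sqrt (2 * pi).

Definition shift0 {R : realType} (t : R) (w : nat -> R) : nat -> R :=
  fun i => if i is i'.+1 then w i' else t.

(* gint k f = E[f(g_0, ..., g_{k-1})] with g_0,...,g_{k-1} i.i.d. N(0,1)
   (iterated Lebesgue integral against the standard Gaussian density;
   coordinates >= k are irrelevant and set to 0). *)
Fixpoint gint {R : realType} (k : nat) (f : (nat -> R) -> R) : R :=
  match k with
  | 0 => f (fun _ => 0)
  | k'.+1 => \int[@lebesgue_measure R]_(t in setT)
               (gauss_pdf t * gint k' (fun w => f (shift0 t w)))
  end.

Definition colv {R : realType} (m off : nat) (w : nat -> R) : 'cV[R]_m :=
  \col_(a < m) w (off + a)%N.

Definition frob2 {R : realType} {m n : nat} (X : 'M[R]_(m, n)) : R :=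
  \sum_(i < m) \sum_(j < n) X i j ^+ 2.

Definition opnorm {R : realType} {m n : nat} (X : 'M[R]_(m, n)) : R :=
  sup [set r | exists v : 'cV[R]_n, frob2 v <= 1 /\ r = Num.sqrt (frob2 (X *m v))].

Definition bil {R : realType} {d : nat} (x : 'cV[R]_d) (B : 'M[R]_d) (y : 'cV[R]_d) : R :=
  (x^T *m B *m y) 0 0.

Definition psd {R : realType} {d : nat} (S : 'M[R]_d) : Prop :=
  S^T = S /\ forall v : 'cV[R]_d, 0 <= (v^T *m S *m v) 0 0.

(* samples: w encodes n blocks of d+p i.i.d. N(0,1) coordinates;
   x_i = Sigma^{1/2} g_i ~ N(0,Sigma), z_i = Omega^{1/2} h_i ~ N(0,Omega),
   all independent. *)
Definition sample_x {R : realType} {d : nat} (p : nat) (S12 : 'M[R]_d)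
  (i : nat) (w : nat -> R) : 'cV[R]_d := S12 *m colv d (i * (d + p)) w.
Definition sample_z {R : realType} (d : nat) {p : nat} (O12 : 'M[R]_p)
  (i : nat) (w : nat -> R) : 'cV[R]_p := O12 *m colv p (i * (d + p) + d) w.

Definition Lhat {R : realType} {p d : nat} (n : nat) (S12 : 'M[R]_d) (O12 : 'M[R]_p)
  (M : 'M[R]_(p, d)) (A : 'M[R]_(p, d)) (B : 'M[R]_d) (w : nat -> R) : R :=
  let x i := sample_x p S12 i w in
  let z i := sample_z d O12 i w in
  let att i := (\sum_(j < n) expR (bil (x i) B (x j)))^-1 *:
               \sum_(j < n) (expR (bil (x i) B (x j)) *: x j) in
  (2 * n%:R)^-1 * \sum_(i < n) frob2 (A *m att i - (M *m x i + z i)).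

Definition Lpop {R : realType} {p d : nat} (S12 : 'M[R]_d) (O12 : 'M[R]_p)
  (M : 'M[R]_(p, d)) (A : 'M[R]_(p, d)) (B : 'M[R]_d) : R :=
  let x2 v := S12 *m colv d 0 v in
  let att (x1 : 'cV[R]_d) :=
    (gint d (fun v => expR (bil x1 B (x2 v))))^-1 *:
    (\col_(a < d) gint d (fun v => expR (bil x1 B (x2 v)) * x2 v a 0)) in
  2^-1 * gint (d + p) (fun w =>
    let x1 := S12 *m colv d 0 w in
    let z1 := O12 *m colv p d w in
    frob2 (A *m att x1 - (M *m x1 + z1))).

Definition gradA {R : realType} {p d : nat} (F : 'M[R]_(p, d) -> 'M[R]_d -> R)
  (A : 'M[R]_(p, d)) (B : 'M[R]_d) : 'M[R]_(p, d) :=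
  \matrix_(i, j) derive1 (fun t : R => F (A + t *: delta_mx i j) B) 0.
Definition gradB {R : realType} {p d : nat} (F : 'M[R]_(p, d) -> 'M[R]_d -> R)
  (A : 'M[R]_(p, d)) (B : 'M[R]_d) : 'M[R]_d :=
  \matrix_(i, j) derive1 (fun t : R => F A (B + t *: delta_mx i j)) 0.

Definition EgradLhatA {R : realType} {p d : nat} (n : nat) (S12 : 'M[R]_d) (O12 : 'M[R]_p)
  (M A : 'M[R]_(p, d)) (B : 'M[R]_d) : 'M[R]_(p, d) :=
  \matrix_(i, j) gint (n * (d + p)) (fun w =>
     gradA (fun A' B' => Lhat n S12 O12 M A' B' w) A B i j).
Definition EgradLhatB {R : realType} {p d : nat} (n : nat) (S12 : 'M[R]_d) (O12 : 'M[R]_p)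
  (M A : 'M[R]_(p, d)) (B : 'M[R]_d) : 'M[R]_d :=
  \matrix_(i, j) gint (n * (d + p)) (fun w =>
     gradB (fun A' B' => Lhat n S12 O12 M A' B' w) A B i j).

Definition diag_sqrt {R : realType} {d : nat} (G : 'M[R]_d) : 'M[R]_d :=
  \matrix_(i, j) Num.sqrt (G i j).

(* P-norm of theta = (A;B), P = diag(I_p, Sigma) *)
Definition Pnorm {R : realType} {p d : nat} (Sigma : 'M[R]_d)
  (A : 'M[R]_(p, d)) (B : 'M[R]_d) : R :=
  Num.sqrt (frob2 A + \tr (B^T *m Sigma *m B)).

Definition SA {R : realType} {p d : nat} (S12 : 'M[R]_d) (U : 'M[R]_(p, d)) (G J : 'M[R]_d)
  : 'M[R]_(p, d) := U *m diag_sqrt G *m J^T *m invmx S12.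
Definition SB {R : realType} {d : nat} (S12 V G J : 'M[R]_d) : 'M[R]_d :=
  invmx S12 *m V *m diag_sqrt G *m J^T *m invmx S12.

Definition close_to_S {R : realType} {p d : nat} (eps : R) (Sigma S12 : 'M[R]_d)
  (U : 'M[R]_(p, d)) (G V : 'M[R]_d) (A : 'M[R]_(p, d)) (B : 'M[R]_d) : Prop :=
  exists J : 'M[R]_d, J^T *m J = 1%:M /\
    Pnorm Sigma (A - SA S12 U G J) (B - SB S12 V G J) <= eps.

(* Main.v *)
(* The constant may be taken to be 1 and k = 0: since N may depend on all the
   data and log n tends to infinity, a bias O(1/n) in every entry is enough.

   Write x_j = Sigma^{1/2} g_j and K = Sigma^{1/2} B Sigma^{1/2}; closeness to S
   forces ||K|| <= 1/16.  Let p_j be the softmax weights of query i, G = sum_j p_j g_j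
   and u = K^T g_i.  Since d p_j / d g_j = u p_j (1 - p_j), Stein's identity in g_j
   replaces each factor g_j in an average sum_j p_j g_j Q_j by u, up to terms
   carrying p_j^2 or p_i.  Hence E[F G] = E[F u] + O(1/n), and the softmax
   covariance may be replaced by the identity.  The population attention is exactly
   Sigma B^T x by the same identity, so the limits are the entries of the gradient
   of L.

   The error terms are controlled by p_a p_b p_c <= n^-4 sum_k w_a w_b w_c / w_k^3
   with w_j = exp(g_i^T K g_j) <= exp((|g_i|^2 + |g_j|^2) / 32), whose Gaussian
   expectation is O(n^-3). *)
From Pilot Require Import Defs.
From HB Require Import structures.
From mathcomp Require Import all_boot all_order all_algebra.
From mathcomp Require Import all_classical all_reals all_analysis.
From mathcomp Require Import measurable_realfun ring lra.
Import Order.TTheory GRing.Theory Num.Theory.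
Import numFieldNormedType.Exports.
Set Implicit Arguments. Unset Strict Implicit. Unset Printing Implicit Defensive.
Local Open Scope classical_set_scope.
Local Open Scope ring_scope.

(** Two obstacles shape the proof. Expectations are iterated one-dimensional integrals, and the
    integral of a non-integrable function is a meaningless default, so linearity, monotonicity and
    exchange of integrals require integrability at every level. The class [nice] provides it:
    measurability for the product sigma-algebra and a bound by a multiple of [expR (lam * |w|^2)].
    It is qualitative only, the constant being free to depend on the number of coordinates, which
    grows with n. Error rates must instead be uniform in n. They are proved for families ([fam]) of
    polynomial growth in the query, the key and an attention average of squared norms. Jensen's
    inequality turns a power of that average into one more softmax weight; this is why products of
    three weights are estimated although Stein's identity leaves only p_j^2 or p_i. Each such
    product is bounded by a sum of functions of a single sample, so that a term costs [Kexp ^+ q],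
    with q = d + p, and not a power growing with n. The limits themselves are Gaussian second
    moments, and [approx] lets them be computed by plain algebra. *)

Local Notation shift0 := Pilot.Defs.shift0.

(** * Measurability of functions of a sequence of reals *)

Section measurable_sequences.
Context {R : realType}.
Implicit Types (w : nat -> R) (k m : nat).

(** Generators of the product sigma-algebra. Working on whole sequences, as [gint] does, avoids
    types that depend on the number of coordinates. *)
Definition cylinders : set (set (nat -> R)) :=
  [set A | exists i (B : set R), measurable B /\ A = (fun w => w i) @^-1` B].

Definition seqT := g_sigma_algebraType cylinders.

Definition smeas (f : (nat -> R) -> R) := measurable_fun [set: seqT] (f : seqT -> R).

Lemma smeas_coord i : smeas (fun w => w i).
Proof.
by move=> _ B mB; rewrite setTI; apply: sub_sigma_algebra; exists i, B.
Qed.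

Lemma measurable_to_seqT d (T : measurableType d) (h : T -> seqT) :
  (forall i, measurable_fun setT (fun x => h x i : R)) -> measurable_fun setT h.
Proof.
move=> mh; apply: (@measurability _ _ T seqT setT h cylinders) => //.
move=> _ [_ [i [B [mB ->]]] <-]; exact: mh.
Qed.

Lemma measurable_shift0 d (T : measurableType d) (a : T -> R) (h : T -> seqT) :
  measurable_fun setT a -> measurable_fun setT h ->
  measurable_fun setT (fun x => shift0 (a x) (h x) : seqT).
Proof.
move=> ma mh; apply: measurable_to_seqT => -[//|i] /=.
exact: (measurableT_comp (smeas_coord i)).
Qed.

Lemma smeas_shift0 t f : smeas f -> smeas (fun w => f (shift0 t w)).
Proof.
move=> mf; apply: (@measurableT_comp _ _ _ _ _ _ _ _ (fun w : seqT => shift0 t w : seqT)) => //.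
by apply: measurable_shift0 => //; exact: measurable_id.
Qed.

Lemma smeas_cst (c : R) : smeas (fun=> c).
Proof. exact: measurable_cst. Qed.

Lemma smeasD f g : smeas f -> smeas g -> smeas (fun w => f w + g w).
Proof. exact: measurable_funD. Qed.

Lemma smeasN f : smeas f -> smeas (fun w => - f w).
Proof. by move=> mf; exact: measurableT_comp. Qed.

Lemma smeasM f g : smeas f -> smeas g -> smeas (fun w => f w * g w).
Proof. exact: measurable_funM. Qed.

Lemma smeasX f m : smeas f -> smeas (fun w => f w ^+ m).
Proof. exact: measurable_funX. Qed.

Lemma smeas_sum (I : Type) (s : seq I) (h : I -> (nat -> R) -> R) :
  (forall i, smeas (h i)) -> smeas (fun w => \sum_(i <- s) h i w).
Proof. exact: measurable_sum. Qed.

Lemma smeas_expR f : smeas f -> smeas (fun w => expR (f w)).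
Proof. by move=> mf; apply: measurableT_comp => //; exact: measurable_expR. Qed.

(** For positive [f] the inverse is [expR (- ln f)], a composition of measurable functions. *)
Lemma smeasV f : (forall w, 0 < f w) -> smeas f -> smeas (fun w => (f w)^-1).
Proof.
move=> f0 mf; rewrite (_ : (fun _ => _) = (fun w => expR (- ln (f w)))).
  apply: smeas_expR; apply: smeasN.
  exact: (measurableT_comp (@measurable_ln R) mf).
by apply/funext => w; rewrite expRN lnK// posrE.
Qed.

End measurable_sequences.

(** * The Gaussian weight and the admissible exponential growth *)

Section gauss_weight.
Context {R : realType}.
Notation mu := (@lebesgue_measure R).
Implicit Types (t : R) (h : R -> R).

Lemma gauss_pdfE : @gauss_pdf R = normal_pdf 0 1.
Proof.
apply/funext => t; rewrite normal_pdfE ?oner_neq0// /gauss_pdf mulrC.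
by rewrite /normal_peak /normal_fun subr0 expr1n mul1r mulr_natl.
Qed.

Lemma gauss_pdf_ge0 t : 0 <= gauss_pdf t.
Proof. by rewrite gauss_pdfE normal_pdf_ge0. Qed.

Lemma measurable_gauss_pdf : measurable_fun setT (@gauss_pdf R).
Proof. by rewrite gauss_pdfE; exact: measurable_normal_pdf. Qed.

Lemma Rintegral_gauss_pdf : \int[mu]_(t in setT) gauss_pdf t = 1.
Proof. by rewrite /Rintegral gauss_pdfE integral_normal_pdf. Qed.

(* 7/16 < 1/2 leaves room for polynomial factors on top of the exponent
   12/32 produced by triple products of softmax weights. *)
Definition lam : R := 7 / 16.

Definition Kexp : R := \int[mu]_(t in setT) (gauss_pdf t * expR (lam * t ^+ 2)).

Lemma integrable_gauss_exp :
  mu.-integrable setT (EFin \o (fun t => gauss_pdf t * expR (lam * t ^+ 2))).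
Proof.
(* The exponent is -t^2/2 + 7t^2/16 = -t^2/16, that of a centred normal density of variance 8. *)
pose s : R := Num.sqrt 8.
have s0 : s != 0 by rewrite gt_eqF// sqrtr_gt0.
rewrite (_ : _ \o _ = fun t =>
    (((normal_peak s)^-1 / Num.sqrt (2 * pi))%:E * (normal_pdf 0 s t)%:E)%E).
  by apply: integrableZl => //; exact: integrable_normal_pdf.
apply/funext => t /=; rewrite normal_pdfE// -EFinM; congr EFin.
rewrite /gauss_pdf mulrAC -expRD; set c := (Num.sqrt _)^-1.
rewrite (_ : expR _ = normal_fun 0 s t); last first.
  by rewrite /normal_fun subr0 sqr_sqrtr//; congr expR; rewrite /lam; field.
by field; rewrite gt_eqF ?normal_peak_gt0.
Qed.

Lemma integrable_gaussM h (C : R) : measurable_fun setT h ->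
  (forall t, `|h t| <= C * expR (lam * t ^+ 2)) ->
  mu.-integrable setT (EFin \o (fun t => gauss_pdf t * h t)).
Proof.
move=> mh hC.
apply: (@le_integrable _ _ R mu setT measurableT _
  (fun t : R => (C%:E * (gauss_pdf t * expR (lam * t ^+ 2))%:E)%E)).
- apply/measurable_EFinP; apply: measurable_funM => //.
  exact: measurable_gauss_pdf.
- move=> t _; rewrite /= lee_fin normrM (ger0_norm (gauss_pdf_ge0 _)).
  rewrite mulrCA; apply: (le_trans _ (ler_norm _)).
  by apply: ler_wpM2l; first exact: gauss_pdf_ge0.
- by apply: integrableZl => //; exact: integrable_gauss_exp.
Qed.

Lemma Kexp_ge1 : 1 <= Kexp.
Proof.
rewrite -Rintegral_gauss_pdf /Kexp; apply: le_Rintegral => //.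
- by rewrite gauss_pdfE; exact: integrable_normal_pdf.
- exact: integrable_gauss_exp.
- move=> t _; rewrite ler_peMr ?gauss_pdf_ge0//.
  by rewrite -expR0 ler_expR mulr_ge0// ?sqr_ge0// /lam divr_ge0.
Qed.

End gauss_weight.

(** * Integrability, linearity and monotonicity of iterated Gaussian integrals *)

Section gint_theory.
Context {R : realType}.
Notation mu := (@lebesgue_measure R).
Notation seqT := (@seqT R).
Implicit Types (w : nat -> R) (k m : nat) (f g : (nat -> R) -> R) (I : nat -> bool).

(** Tonelli's theorem gives measurability for the positive and the negative part separately, so no
    integrability is involved; [fine] is measurable too. *)
Lemma measurable_integral_param d (T : measurableType d) (h : T * R -> R) :
  measurable_fun setT h ->
  measurable_fun setT (fun y => \int[mu]_(t in setT) h (y, t)).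
Proof.
move=> mh; have mh' : measurable_fun setT (EFin \o h) by exact/measurable_EFinP.
apply: (measurableT_comp (fine_measurable measurableT)).
rewrite (_ : (fun _ => _) = (fun y => fubini_F mu ((EFin \o h)^\+)%E y -
   fubini_F mu ((EFin \o h)^\-)%E y)%E); last first.
  apply/funext => y; rewrite /fubini_F [LHS]integralE.
  by congr (_ - _)%E; apply: eq_integral => t _; rewrite ?funeposE ?funenegE.
have mp : measurable_fun setT (fubini_F mu ((EFin \o h)^\+)%E).
  apply: measurable_fun_fubini_tonelli_F; first exact: measurable_funepos.
  by move=> x; rewrite funepos_ge0.
have mn : measurable_fun setT (fubini_F mu ((EFin \o h)^\-)%E).
  apply: measurable_fun_fubini_tonelli_F; first exact: measurable_funeneg.
  by move=> x; rewrite funeneg_ge0.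
exact: emeasurable_funB.
Qed.

(** The parameter space has to vary in the induction: the outermost integration variable becomes a
    further parameter, and [T] turns into [T * R]. *)
Lemma measurable_gint d (T : measurableType d) k (F : T -> seqT -> R) :
  measurable_fun setT (fun x : T * seqT => F x.1 x.2) ->
  measurable_fun setT (fun y => gint k (F y)).
Proof.
elim: k d T F => [|k IH] d T F mF /=.
  apply: (@measurableT_comp _ _ _ _ _ _ _ _ (fun y : T => (y, (fun=> 0) : seqT)) mF).
  by apply: measurable_fun_pair => //; exact: measurable_id.
apply: (@measurable_integral_param _ _
  (fun x => gauss_pdf x.2 * gint k (fun w => F x.1 (shift0 x.2 w)))).
apply: measurable_funM.
  exact: (measurableT_comp measurable_gauss_pdf measurable_snd).
apply: (IH _ _ (fun x w => F x.1 (shift0 x.2 w))).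
apply: (@measurableT_comp _ _ _ _ _ _ _ _
  (fun z : (T * R) * seqT => (z.1.1, shift0 z.1.2 z.2 : seqT)) mF).
apply: measurable_fun_pair.
  exact: (measurableT_comp measurable_fst measurable_fst).
apply: measurable_shift0 => //.
exact: (measurableT_comp measurable_snd measurable_fst).
Qed.

Lemma measurable_gint_shift k f : smeas f ->
  measurable_fun setT (fun t => gint k (fun w => f (shift0 t w))).
Proof.
move=> mf; apply: (@measurable_gint _ _ k (fun t w => f (shift0 t w))).
apply: (@measurableT_comp _ _ _ _ _ _ _ _
  (fun z : R * seqT => shift0 z.1 z.2 : seqT) mf).
exact: measurable_shift0.
Qed.

Definition wsum I k w : R := \sum_(i < k) (I i)%:R * w i ^+ 2.

Lemma wsum_ge0 I k w : 0 <= wsum I k w.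
Proof. by apply: sumr_ge0 => i _; rewrite mulr_ge0// ?ler0n ?sqr_ge0. Qed.

Lemma wsumS I k t w :
  wsum I k.+1 (shift0 t w) = (I 0)%:R * t ^+ 2 + wsum (fun i => I i.+1) k w.
Proof. by rewrite /wsum big_ord_recl. Qed.

(** Growth is allowed only in the coordinates selected by [I]. Those outside contribute a factor 1
    to [gint_bound], which is what later makes estimates independent of the sample size. *)
Definition gdom I (C : R) k f := forall w, `|f w| <= C * expR (lam * wsum I k w).

Definition Kprod I k : R := \prod_(i < k) (if I i then Kexp else 1).

Lemma Kprod_ge0 I k : 0 <= Kprod I k.
Proof.
apply: prodr_ge0 => i _; case: ifP => // _.
exact: le_trans ler01 Kexp_ge1.
Qed.

Lemma KprodS I k :
  Kprod I k.+1 = (if I 0 then Kexp else 1) * Kprod (fun i => I i.+1) k.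
Proof. by rewrite /Kprod big_ord_recl. Qed.

Lemma gdom_shift I C k f t : gdom I C k.+1 f ->
  gdom (fun i => I i.+1) (C * expR (lam * ((I 0)%:R * t ^+ 2))) k
    (fun w => f (shift0 t w)).
Proof.
by move=> fC w; apply: (le_trans (fC _)); rewrite wsumS mulrDr expRD mulrA.
Qed.

Lemma gdom_ge0 I C k f : gdom I C k f -> 0 <= C.
Proof.
move=> /(_ (fun=> 0)) /(le_trans (normr_ge0 _)).
by rewrite pmulr_lge0// expR_gt0.
Qed.

Lemma le_lam_ind I t : expR (lam * ((I 0)%:R * t ^+ 2)) <= expR (lam * t ^+ 2) :> R.
Proof.
rewrite ler_expR ler_wpM2l ?divr_ge0//.
by case: (I 0); rewrite ?mul1r// mul0r sqr_ge0.
Qed.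

Lemma Rintegral_gauss_ind I :
  \int[mu]_(t in setT) (gauss_pdf t * expR (lam * ((I 0)%:R * t ^+ 2))) =
  if I 0 then Kexp else 1.
Proof.
case: (I 0); first by under eq_Rintegral do rewrite mul1r.
under eq_Rintegral do rewrite mul0r mulr0 expR0 mulr1.
exact: Rintegral_gauss_pdf.
Qed.

Lemma gint_bound I C k f : smeas f -> gdom I C k f -> `|gint k f| <= C * Kprod I k.
Proof.
elim: k I C f => [|k IH] I C f mf fC.
  have := fC (fun=> 0); rewrite /= /Kprod /wsum !big_ord0 mulr0 expR0; exact.
have C0 := gdom_ge0 fC.
have inner t : `|gint k (fun w => f (shift0 t w))| <=
    C * Kprod (fun i => I i.+1) k * expR (lam * ((I 0)%:R * t ^+ 2)).
  rewrite mulrAC; apply: IH; [exact: smeas_shift0|exact: gdom_shift].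
have K0 := Kprod_ge0 (fun i => I i.+1) k.
(* This weaker form, with full growth in [t], serves integrability; the bound [inner] keeps the
   sharp factor for a coordinate outside [I]. *)
have inner' t : `|gint k (fun w => f (shift0 t w))| <=
    C * Kprod (fun i => I i.+1) k * expR (lam * t ^+ 2).
  by apply: (le_trans (inner t)); rewrite ler_wpM2l ?mulr_ge0// le_lam_ind.
have int1 := integrable_gaussM (measurable_gint_shift k mf) inner'.
have int2 : mu.-integrable setT
    (EFin \o (fun t : R => gauss_pdf t * expR (lam * ((I 0)%:R * t ^+ 2)))).
  apply: (@integrable_gaussM _ _ 1).
  - apply: (measurableT_comp (@measurable_expR R)).
    by do 2 apply: measurable_funM => //; exact: exprn_measurable.
  - by move=> t; rewrite ger0_norm ?expR_ge0// mul1r le_lam_ind.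
rewrite /=; apply: (le_trans (le_normr_Rintegral _ int1)) => //.
apply: (@le_trans _ _ (\int[mu]_(t in setT) (C * Kprod (fun i => I i.+1) k *
   (gauss_pdf t * expR (lam * ((I 0)%:R * t ^+ 2)))))).
  apply: le_Rintegral => //.
  - exact: (integrable_abse int1).
  - have := @integrableZl _ _ _ mu setT measurableT
      (C * Kprod (fun i => I i.+1) k) _ int2.
    by under eq_fun do rewrite -EFinM.
  - move=> t _; rewrite normrM (ger0_norm (gauss_pdf_ge0 _)) mulrCA.
    by apply: ler_wpM2l; first exact: gauss_pdf_ge0.
rewrite RintegralZl// Rintegral_gauss_ind KprodS.
by rewrite -mulrA [X in C * X <= _]mulrC.
Qed.

(** The condition survives freezing the first coordinate, whose square is absorbed in the constant,
    so it gives integrability at all levels of [gint]. *)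
Definition nice k f := smeas f /\ exists C, gdom xpredT C k f.

Lemma nice_shift k f t : nice k.+1 f -> nice k (fun w => f (shift0 t w)).
Proof.
move=> [mf [C fC]]; split; first exact: smeas_shift0.
by exists (C * expR (lam * (1 * t ^+ 2))); exact: gdom_shift fC.
Qed.

Lemma nice_gint_bound k f : nice k.+1 f -> exists C, forall t,
  `|gint k (fun w => f (shift0 t w))| <= C * expR (lam * t ^+ 2).
Proof.
move=> [mf [C fC]]; exists (C * Kprod xpredT k) => t.
have /(gint_bound (smeas_shift0 t mf)) := gdom_shift t fC.
by rewrite mul1r mulrAC.
Qed.

Lemma nice_integrable k f : nice k.+1 f -> mu.-integrable setT
  (EFin \o (fun t => gauss_pdf t * gint k (fun w => f (shift0 t w)))).
Proof.
move=> nf; have [C fC] := nice_gint_bound nf.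
by apply: (integrable_gaussM _ fC); apply: measurable_gint_shift; case: nf.
Qed.

Lemma niceD k f g : nice k f -> nice k g -> nice k (fun w => f w + g w).
Proof.
move=> [mf [C fC]] [mg [D gD]]; split; first exact: smeasD.
exists (C + D) => w; rewrite mulrDl (le_trans (ler_normD _ _))//.
by apply: lerD; [exact: fC|exact: gD].
Qed.

Lemma niceZ k c f : nice k f -> nice k (fun w => c * f w).
Proof.
move=> [mf [C fC]]; split; first by apply: smeasM => //; exact: smeas_cst.
by exists (`|c| * C) => w; rewrite normrM -mulrA ler_wpM2l.
Qed.

Lemma nice_cst k c : nice k (fun=> c).
Proof.
split; first exact: smeas_cst.
exists `|c| => w; rewrite ler_peMr// -expR0 ler_expR mulr_ge0 ?wsum_ge0//.
by rewrite divr_ge0.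
Qed.

Lemma niceN k f : nice k f -> nice k (fun w => - f w).
Proof.
move=> nf; rewrite (_ : (fun _ => _) = (fun w => -1 * f w)); first exact: niceZ.
by apply/funext => w; rewrite mulN1r.
Qed.

Lemma nice_sum k (J : Type) (s : seq J) (h : J -> (nat -> R) -> R) :
  (forall j, nice k (h j)) -> nice k (fun w => \sum_(j <- s) h j w).
Proof.
move=> nh; elim: s => [|j s IH].
  by under eq_fun do rewrite big_nil; exact: nice_cst.
by under eq_fun do rewrite big_cons; exact: niceD.
Qed.

Lemma eq_gint k f g : f =1 g -> gint k f = gint k g.
Proof. by move=> /funext ->. Qed.

Lemma gintD k f g : nice k f -> nice k g ->
  gint k (fun w => f w + g w) = gint k f + gint k g.
Proof.
elim: k f g => [//|k IH] f g nf ng /=.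
rewrite -RintegralD//; [|exact: nice_integrable|exact: nice_integrable].
apply: eq_Rintegral => t _; rewrite -mulrDr; congr (_ * _).
by apply: IH; exact: nice_shift.
Qed.

Lemma gintZ k c f : nice k f -> gint k (fun w => c * f w) = c * gint k f.
Proof.
elim: k f => [//|k IH] f nf /=.
rewrite -RintegralZl//; last exact: nice_integrable.
apply: eq_Rintegral => t _; rewrite mulrCA; congr (_ * _).
by apply: IH; exact: nice_shift.
Qed.

Lemma gint_cst k c : gint k (fun=> c) = c :> R.
Proof.
elim: k => [//|k IH] /=; under eq_Rintegral do rewrite IH.
rewrite RintegralZr ?Rintegral_gauss_pdf ?mul1r//.
by rewrite gauss_pdfE; exact: integrable_normal_pdf.
Qed.

Lemma gintN k f : nice k f -> gint k (fun w => - f w) = - gint k f.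
Proof.
move=> nf; rewrite -mulN1r -gintZ//.
by apply: eq_gint => w; rewrite mulN1r.
Qed.

Lemma gintB k f g : nice k f -> nice k g ->
  gint k (fun w => f w - g w) = gint k f - gint k g.
Proof. by move=> nf ng; rewrite gintD ?gintN//; exact: niceN. Qed.

Lemma gint_sum k (J : Type) (s : seq J) (h : J -> (nat -> R) -> R) :
  (forall j, nice k (h j)) ->
  gint k (fun w => \sum_(j <- s) h j w) = \sum_(j <- s) gint k (h j).
Proof.
move=> nh; elim: s => [|j s IH].
  by under eq_gint do rewrite big_nil; rewrite gint_cst big_nil.
under eq_gint do rewrite big_cons.
by rewrite gintD ?big_cons ?IH//; exact: nice_sum.
Qed.

Lemma le_gint k f g : nice k f -> nice k g -> (forall w, f w <= g w) ->
  gint k f <= gint k g.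
Proof.
elim: k f g => [|k IH] f g nf ng fg /=; first exact: fg.
apply: le_Rintegral => //; [exact: nice_integrable|exact: nice_integrable|].
move=> t _; apply: ler_wpM2l; first exact: gauss_pdf_ge0.
by apply: IH => //; exact: nice_shift.
Qed.

Lemma le_norm_gint k f g : nice k f -> nice k g -> (forall w, `|f w| <= g w) ->
  `|gint k f| <= gint k g.
Proof.
move=> nf ng fg; rewrite ler_norml -gintN//; apply/andP; split.
  apply: le_gint => //; first exact: niceN.
  by move=> w; rewrite lerNl (le_trans (ler_norm _))// normrN.
by apply: le_gint => // w; exact: le_trans (ler_norm _) (fg w).
Qed.

End gint_theory.

(** * Exchange of Gaussian integrals *)

Section stein.
Context {R : realType}.
Notation mu := (@lebesgue_measure R).
Notation seqT := (@seqT R).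
Implicit Types (w : nat -> R) (k m : nat) (f g : (nat -> R) -> R).

(** The bound factorizes into functions of [t] and of [s], so the double integral of the modulus is
    at most [C * Kexp ^+ 2] and Fubini's theorem applies. Finiteness of the inner integrals ([E1],
    [E2]) makes the extended integrals agree with the real ones. *)
Lemma gauss_Fubini (q : R * R -> R) (C : R) : measurable_fun setT q ->
  (forall t s, `|q (t, s)| <= C * expR (lam * t ^+ 2) * expR (lam * s ^+ 2)) ->
  \int[mu]_(t in setT)
    (gauss_pdf t * \int[mu]_(s in setT) (gauss_pdf s * q (t, s))) =
  \int[mu]_(s in setT)
    (gauss_pdf s * \int[mu]_(t in setT) (gauss_pdf t * q (t, s))).
Proof.
move=> mq qC.
have C0 : 0 <= C.
  have := le_trans (normr_ge0 _) (qC 0 0).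
  by rewrite -mulrA pmulr_lge0// mulr_gt0 ?expR_gt0.
have mq1 t : measurable_fun setT (fun s => q (t, s)).
  apply: (@measurableT_comp _ _ _ _ _ _ _ _ (fun s => (t, s)) mq).
  by apply: measurable_fun_pair => //; exact: measurable_id.
have mq2 s : measurable_fun setT (fun t => q (t, s)).
  apply: (@measurableT_comp _ _ _ _ _ _ _ _ (fun t => (t, s)) mq).
  by apply: measurable_fun_pair => //; exact: measurable_id.
have i1 t : mu.-integrable setT (EFin \o (fun s => gauss_pdf s * q (t, s))).
  by apply: integrable_gaussM (mq1 t) (qC t).
have i2 s : mu.-integrable setT (EFin \o (fun t => gauss_pdf t * q (t, s))).
  apply: (integrable_gaussM (C := C * expR (lam * s ^+ 2)) (mq2 s)) => t.
  by apply: (le_trans (qC t s)); rewrite mulrAC.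
pose H (z : R * R) := gauss_pdf z.1 * (gauss_pdf z.2 * q z).
have mH : measurable_fun setT H.
  apply: measurable_funM.
    exact: (measurableT_comp measurable_gauss_pdf measurable_fst).
  apply: measurable_funM => //.
  exact: (measurableT_comp measurable_gauss_pdf measurable_snd).
have Zint (c : R) (h : R -> R) : mu.-integrable setT (EFin \o h) ->
    mu.-integrable setT (EFin \o (fun t => c * h t)).
  by move=> /(@integrableZl _ _ _ mu setT measurableT c).
have E1 t : (\int[mu]_s (H (t, s))%:E)%E =
    (gauss_pdf t * \int[mu]_(s in setT) (gauss_pdf s * q (t, s)))%:E.
  rewrite -RintegralZl// /Rintegral fineK//.
  by apply: integrable_fin_num => //; exact: (Zint _ _ (i1 t)).
have E2 s : (\int[mu]_t (H (t, s))%:E)%E =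
    (gauss_pdf s * \int[mu]_(t in setT) (gauss_pdf t * q (t, s)))%:E.
  rewrite -RintegralZl// /Rintegral fineK//.
    by apply: eq_integral => t _; rewrite /H/= mulrCA.
  by apply: integrable_fin_num => //; exact: (Zint _ _ (i2 s)).
have intH : (mu \x mu)%E.-integrable setT (EFin \o H).
  apply/integrable12ltyP; first exact/measurable_EFinP.
  apply: (@le_lt_trans _ _ (\int[mu]_t
    ((C * Kexp) * (gauss_pdf t * expR (lam * t ^+ 2)))%:E)%E).
    apply: ge0_le_integral => //.
    - by move=> t _; apply: integral_ge0.
    - have mF : measurable_fun setT (fubini_F mu (fun z => `|(EFin \o H) z|)%E).
        apply: measurable_fun_fubini_tonelli_F => //.
        apply: measurableT_comp => //; exact/measurable_EFinP.
      exact: mF.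
    - apply/measurable_EFinP; apply: measurable_funM => //.
      apply: measurable_funM; first exact: measurable_gauss_pdf.
      apply: (measurableT_comp (@measurable_expR R)).
      by apply: measurable_funM => //; exact: exprn_measurable.
    move=> t _.
    have -> : ((C * Kexp) * (gauss_pdf t * expR (lam * t ^+ 2)))%:E =
      (\int[mu]_s ((C * (gauss_pdf t * expR (lam * t ^+ 2))) *
         (gauss_pdf s * expR (lam * s ^+ 2)))%:E)%E.
      rewrite mulrAC /Kexp -RintegralZl//; last exact: integrable_gauss_exp.
      rewrite /Rintegral fineK//; apply: integrable_fin_num => //.
      exact: (Zint _ _ integrable_gauss_exp).
    apply: ge0_le_integral => //.
    - have mHt : measurable_fun setT (fun s => (H (t, s))%:E).
        apply/measurable_EFinP; rewrite /H/=.
        apply: measurable_funM; first exact: measurable_cst.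
        by apply: measurable_funM => /=; [exact: measurable_gauss_pdf|exact: mq1].
      exact: (measurableT_comp _ mHt).
    - apply/measurable_EFinP; apply: measurable_funM => //.
      apply: measurable_funM; first exact: measurable_gauss_pdf.
      apply: (measurableT_comp (@measurable_expR R)).
      by apply: measurable_funM => //; exact: exprn_measurable.
    - move=> s _; rewrite -[leLHS]/(`|H (t, s)|%:E) lee_fin.
      rewrite [H _]/(gauss_pdf t * (gauss_pdf s * q (t, s))).
      rewrite normrM (ger0_norm (gauss_pdf_ge0 t)).
      rewrite normrM (ger0_norm (gauss_pdf_ge0 s)).
      rewrite [leRHS](_ : _ = gauss_pdf t * (gauss_pdf s *
        (C * expR (lam * t ^+ 2) * expR (lam * s ^+ 2)))); last by ring.
      by do 2 (apply: ler_wpM2l; first exact: gauss_pdf_ge0).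
  have /integrable_fin_num := Zint (C * Kexp) _ integrable_gauss_exp.
  by move=> /(_ measurableT); rewrite fin_num_abs => /(le_lt_trans (lee_abs _)).
have := Fubini intH; rewrite /=.
under eq_integral do rewrite E1.
under [in X in _ = X]eq_integral do rewrite E2.
by rewrite /Rintegral => ->.
Qed.

(** The variable [t] moves inwards past one coordinate at a time. *)
Lemma gint_swap k (h : R -> seqT -> R) (C : R) :
  measurable_fun setT (fun x : R * seqT => h x.1 x.2) ->
  (forall t w, `|h t w| <=
    C * expR (lam * t ^+ 2) * expR (lam * wsum xpredT k w)) ->
  \int[mu]_(t in setT) (gauss_pdf t * gint k (h t)) =
  gint k (fun w => \int[mu]_(t in setT) (gauss_pdf t * h t w)).
Proof.
elim: k h C => [//|k IH] h C mh hC /=.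
have mh' t : smeas (h t).
  apply: (@measurableT_comp _ _ _ _ _ _ _ _ (fun w : seqT => (t, w)) mh).
  by apply: measurable_fun_pair => //; exact: measurable_id.
have bd t s : gdom xpredT (C * expR (lam * t ^+ 2) * expR (lam * s ^+ 2)) k
    (fun w => h t (shift0 s w)).
  by move=> w; rewrite (le_trans (hC _ _))// wsumS mul1r mulrDr expRD !mulrA.
rewrite (@gauss_Fubini (fun z => gint k (fun w => h z.1 (shift0 z.2 w)))
  (C * Kprod xpredT k)).
- apply: eq_Rintegral => s _; congr (_ * _).
  apply: (IH (fun t w => h t (shift0 s w)) (C * expR (lam * s ^+ 2))).
    apply: (@measurableT_comp _ _ _ _ _ _ _ _
      (fun z : R * seqT => (z.1, shift0 s z.2 : seqT)) mh).
    by apply: measurable_fun_pair => //; exact: measurable_shift0.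
  by move=> t w; rewrite (le_trans (bd t s w))// [C * _ * _]mulrAC.
- apply: (@measurable_gint _ _ _ k (fun z w => h z.1 (shift0 z.2 w))).
  apply: (@measurableT_comp _ _ _ _ _ _ _ _
    (fun z : (R * R) * seqT => (z.1.1, shift0 z.1.2 z.2 : seqT)) mh).
  apply: measurable_fun_pair.
    exact: (measurableT_comp measurable_fst measurable_fst).
  apply: measurable_shift0 => //.
  exact: (measurableT_comp measurable_snd measurable_fst).
- move=> t s /=.
  have := gint_bound (smeas_shift0 s (mh' t)) (bd t s).
  by rewrite mulrAC [C * _ * Kprod _ _]mulrAC.
Qed.

End stein.

(** * Differentiation rules in pointwise form *)

Section derive_rules.
Context {R : realType}.
Implicit Types (f g : R -> R) (t : R).

Lemma is_derive_subst f t (a b : R) : is_derive t 1 f a -> a = b ->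
  is_derive t 1 f b.
Proof. by move=> ? <-. Qed.

Lemma is_derive_fcst (c t : R) : is_derive t 1 (fun _ : R => c) 0.
Proof. exact: is_derive_cst. Qed.

Lemma is_derive_fid t : is_derive t 1 (fun s : R => s) 1.
Proof. exact: is_derive_id. Qed.

Lemma is_derive_fD f g t df dg : is_derive t 1 f df -> is_derive t 1 g dg ->
  is_derive t 1 (fun s => f s + g s) (df + dg).
Proof. by move=> ? ?; exact: is_deriveD. Qed.

Lemma is_derive_fB f g t df dg : is_derive t 1 f df -> is_derive t 1 g dg ->
  is_derive t 1 (fun s => f s - g s) (df - dg).
Proof. by move=> ? ?; exact: is_deriveB. Qed.

Lemma is_derive_fM f g t df dg : is_derive t 1 f df -> is_derive t 1 g dg ->
  is_derive t 1 (fun s => f s * g s) (df * g t + f t * dg).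
Proof.
move=> df' dg'; apply: (is_derive_subst (is_deriveM df' dg')).
by rewrite /GRing.scale /= addrC [g t * _]mulrC.
Qed.

Lemma is_derive_fexp f t df : is_derive t 1 f df ->
  is_derive t 1 (fun s => expR (f s)) (df * expR (f t)).
Proof. by move=> ?; apply: is_derive_eq; rewrite mulrC. Qed.

Lemma is_derive_fV f t df : f t != 0 -> is_derive t 1 f df ->
  is_derive t 1 (fun s => (f s)^-1) (- df / f t ^+ 2).
Proof.
by move=> ? ?; apply: is_derive_eq; rewrite /GRing.scale/= mulrC mulNr mulrN.
Qed.

Lemma is_derive_fsum (J : Type) (s : seq J) (h : J -> R -> R) (dh : J -> R) t :
  (forall j, is_derive t 1 (h j) (dh j)) ->
  is_derive t 1 (fun x => \sum_(j <- s) h j x) (\sum_(j <- s) dh j).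
Proof.
move=> dhj; elim: s => [|j s IH].
  by under eq_fun do rewrite big_nil; rewrite big_nil; exact: is_derive_fcst.
by under eq_fun do rewrite big_cons; rewrite big_cons; exact: is_derive_fD.
Qed.

Lemma is_derive_continuous f t df : is_derive t 1 f df -> {for t, continuous f}.
Proof.
move=> [df' _]; exact/differentiable_continuous/derivable1_diffP.
Qed.

Lemma is_derive_derive1 f t df : is_derive t 1 f df -> derive1 f t = df.
Proof. by move=> [_ <-]; rewrite derive1E. Qed.

End derive_rules.

(** * Stein's identity in one variable *)

Section stein1.
Context {R : realType}.
Notation mu := (@lebesgue_measure R).

Lemma is_derive_gauss_pdf (t : R) : is_derive t 1 gauss_pdf (- t * gauss_pdf t).
Proof.
rewrite /gauss_pdf; set c := (Num.sqrt _)^-1.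
by apply: is_derive_eq; rewrite /GRing.scale/=; field.
Qed.

(** The points [n] and [- n] are the endpoints of the truncated intervals used for [stein1]. There
    the product is at most a multiple of [expR (- (n^2 / 16))], and [1 + x <= expR x] turns this
    into a multiple of 1/(n+1). *)
Lemma gauss_pdf_tail (f : R -> R) (C : R) :
  (forall t, `|f t| <= C * expR (lam * t ^+ 2)) ->
  exists D, forall n : nat, `|gauss_pdf n%:R * f n%:R| <= D * harmonic n /\
    `|gauss_pdf (- n%:R) * f (- n%:R)| <= D * harmonic n.
Proof.
move=> fC; pose c : R := (Num.sqrt (2 * pi))^-1.
have c0 : 0 <= c by rewrite invr_ge0.
have C0 : 0 <= C by have := le_trans (normr_ge0 _) (fC 0); rewrite pmulr_lge0 ?expR_gt0.
have H (n : nat) t : t ^+ 2 = n%:R ^+ 2 -> `|gauss_pdf t * f t| <= C * c * 16 * harmonic n.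
  move=> tn; rewrite normrM (ger0_norm (gauss_pdf_ge0 _)).
  apply: (@le_trans _ _ (gauss_pdf t * (C * expR (lam * t ^+ 2)))).
    by apply: ler_wpM2l; first exact: gauss_pdf_ge0.
  rewrite tn /gauss_pdf tn -/c.
  rewrite [leLHS](_ : _ = C * c * (expR (- n%:R ^+ 2 / 2) * expR (lam * n%:R ^+ 2))); last by ring.
  rewrite -[leRHS]mulrA; apply: ler_wpM2l; first exact: mulr_ge0.
  rewrite -expRD (_ : _ + _ = - (n%:R ^+ 2 / 16)); last by rewrite /lam; field.
  rewrite expRN /harmonic/= -[leLHS]mul1r ler_pdivrMr ?expR_gt0//.
  rewrite mulrAC ler_pdivlMr ?ltr0n// mul1r.
  apply: (@le_trans _ _ (16 * (1 + n%:R ^+ 2 / 16))); last first.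
    by rewrite ler_wpM2l// expR_ge1Dx.
  have : n%:R <= n%:R ^+ 2 :> R by rewrite -natrX ler_nat; case: n {tn} => // n; exact: leq_pmulr.
  by rewrite -natr1; lra.
exists (C * c * 16) => n; split; apply: H => //; exact: sqrrN.
Qed.

(** Integration by parts: [F], the density times [f], has as derivative the difference [h] of the
    two integrands. By dominated convergence the integral of [h] is the limit of its integrals over
    [-n, n], which are boundary terms of [F] and tend to 0. *)
Lemma stein1 (f f' : R -> R) (C : R) :
  (forall t : R, is_derive t 1 f (f' t)) -> continuous f' ->
  (forall t, `|f t| <= C * expR (lam * t ^+ 2)) ->
  (forall t, `|t * f t| <= C * expR (lam * t ^+ 2)) ->
  (forall t, `|f' t| <= C * expR (lam * t ^+ 2)) ->
  \int[mu]_(t in setT) (gauss_pdf t * (t * f t)) =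
  \int[mu]_(t in setT) (gauss_pdf t * f' t).
Proof.
move=> df cf' fC tfC f'C.
have cf : continuous f by move=> t; exact: is_derive_continuous (df t).
have cpdf : continuous (@gauss_pdf R).
  by move=> t; exact: is_derive_continuous (is_derive_gauss_pdf t).
have ctf : continuous (fun t : R => t * f t) by move=> t; apply: cvgM; [exact: cvg_id|exact: cf].
have itf := integrable_gaussM (continuous_measurable_fun ctf) tfC.
have if' := integrable_gaussM (continuous_measurable_fun cf') f'C.
apply/eqP; rewrite -subr_eq0 -RintegralB//; apply/eqP.
pose F t := gauss_pdf t * f t.
pose h t := gauss_pdf t * f' t - gauss_pdf t * (t * f t).
have dF (t : R) : is_derive t 1 F (h t).
  apply: (is_derive_subst (is_derive_fM (is_derive_gauss_pdf t) (df t))).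
  by rewrite /h; ring.
have ch : continuous h.
  by move=> t; apply: cvgB; [apply: cvgM; [exact: cpdf|exact: cf']|
    apply: cvgM; [exact: cpdf|exact: ctf]].
have ih : mu.-integrable setT (EFin \o h).
  exact: (integrableB measurableT if' itf).
suff h0 : (\int[mu]_t (h t)%:E = 0)%E.
  rewrite -[RHS]oppr0 -[in RHS](_ : fine 0%E = 0)// -h0.
  rewrite -[RHS]mulN1r -[fine _]/(\int[mu]_(t in setT) h t) -RintegralZl//.
  by apply: eq_Rintegral => t _; rewrite /h; ring.
have mh : measurable_fun setT (EFin \o h).
  by apply/measurable_EFinP; exact: (continuous_measurable_fun ch).
pose f_ (n : nat) : R -> \bar R := (EFin \o h) \_ `[- n%:R, n%:R].
have [_ _ cv] : [/\ mu.-integrable setT (EFin \o h),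
    [sequence \int[mu]_(x in setT) (`|f_ n x - (h x)%:E|)%E]_n @ \oo --> 0%E &
    [sequence \int[mu]_(x in setT) (f_ n x)]_n @ \oo --> \int[mu]_(x in setT) (h x)%:E]%E.
  apply: (@dominated_convergence _ _ R mu setT measurableT f_ (EFin \o h) (abse \o (EFin \o h))).
  - by move=> n; apply/(measurable_restrictT _ _).1 => //; apply: measurable_funTS.
  - exact: mh.
  - apply: aeW => x _; apply: cvg_near_cst; near=> n.
    rewrite /f_ patchE ifT// inE /= in_itv/= -ler_norml.
    near: n; exact: nbhs_infty_ger.
  - exact: integrable_abse.
  - apply: aeW => x n _; rewrite /f_ patchE; case: ifP => // _.
    by rewrite abse0 abse_ge0.
(* The index is shifted because the interval degenerates at 0, while the fundamental theorem is
   applied on a nontrivial interval. *)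
have FTC (n : nat) : (\int[mu]_x f_ n.+1 x)%E = (F n.+1%:R - F (- n.+1%:R))%:E.
  rewrite /f_ -integral_mkcond EFinB.
  apply: continuous_FTC2.
  - by rewrite -subr_gt0 opprK -natrD ltr0n.
  - by apply: continuous_subspaceT.
  - split.
    + by move=> x _; have [] := dF x.
    + by apply: cvg_at_right_filter; exact: is_derive_continuous (dF _).
    + by apply: cvg_at_left_filter; exact: is_derive_continuous (dF _).
  - by move=> x _; exact: is_derive_derive1 (dF x).
have [D HD] := gauss_pdf_tail fC.
have cvF : (F n.+1%:R - F (- n.+1%:R)) @[n --> \oo] --> (0 : R).
  apply/norm_cvg0P.
  apply: (@squeeze_cvgr _ _ _ _ (fun=> 0) (fun n => 2 * D * harmonic n.+1)).
  - near=> n; rewrite normr_ge0/=; have [H1 H2] := HD n.+1.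
    rewrite (le_trans (ler_normB _ _))// -mulrA mulr_natl mulr2n.
    exact: lerD.
  - exact: cvg_cst.
  - rewrite -[X in _ --> X](mulr0 (2 * D)); apply: cvgMr.
    have := @cvg_harmonic R.
    by rewrite -(@cvg_shiftS R^o).
have cvE : (F n.+1%:R - F (- n.+1%:R))%:E @[n --> \oo] --> 0%E.
  by apply: cvg_EFin; [exact: nearW|exact: cvF].
move: cv; rewrite -(@cvg_shiftS (\bar R)) /=.
under eq_fun do rewrite FTC.
by move=> cv; exact: (cvg_unique (@ereal_hausdorff R) cv cvE).
Unshelve. all: by end_near. Qed.

End stein1.

(** * Stein's identity in one coordinate of an iterated integral *)

Section stein_coord.
Context {R : realType}.
Notation mu := (@lebesgue_measure R).
Notation seqT := (@seqT R).
Implicit Types (w : nat -> R) (k m : nat) (f g : (nat -> R) -> R).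

Definition upd w m (t : R) : nat -> R := fun i => if i == m then t else w i.

Lemma upd_shift0 t w s : upd (shift0 t w) 0 s = shift0 s w.
Proof. by apply/funext => -[|i]. Qed.

Lemma upd_shiftS t w m s : upd (shift0 t w) m.+1 s = shift0 t (upd w m s).
Proof. by apply/funext => -[|i]. Qed.

(** The derivative is demanded along the whole coordinate line through each [w], so that freezing
    the other coordinates yields exactly the data of [stein1]. *)
Definition pderiv m f f' := forall w (t : R),
  is_derive t 1 (fun s => f (upd w m s)) (f' (upd w m t)).

Definition pcont m f := forall w, continuous (fun s : R => f (upd w m s)).

(** Coordinate 0 is outermost in [gint]; moved innermost, it is integrated with all others frozen,
    as Stein's identity in one variable requires. *)
Lemma gint_first k f : nice k.+1 f -> gint k.+1 f =
  gint k (fun w => \int[mu]_(t in setT) (gauss_pdf t * f (shift0 t w))).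
Proof.
move=> [mf [C fC]] /=.
apply: (@gint_swap _ k (fun t w => f (shift0 t w)) C).
- apply: (@measurableT_comp _ _ _ _ _ _ _ _
    (fun z : R * seqT => shift0 z.1 z.2 : seqT) mf).
  exact: measurable_shift0.
- by move=> t w; rewrite (le_trans (fC _))// wsumS mul1r mulrDr expRD mulrA.
Qed.

Lemma gdom_le I (C D : R) k f : C <= D -> gdom I C k f -> gdom I D k f.
Proof.
by move=> CD fC w; apply: (le_trans (fC w)); rewrite ler_wpM2r ?expR_ge0.
Qed.

Lemma gdom_line k f C w : gdom xpredT C k.+1 f -> forall t,
  `|f (shift0 t w)| <= C * expR (lam * wsum xpredT k w) * expR (lam * t ^+ 2).
Proof.
move=> fC t; apply: (le_trans (fC _)).
by rewrite wsumS mul1r mulrDr expRD mulrA mulrAC.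
Qed.

(** For a positive index the outermost coordinate is frozen and the induction hypothesis applies
    under the integral. Index 0 is moved innermost, where the identity holds pointwise in the
    remaining coordinates. *)
Theorem stein k m f f' : (m < k)%N -> pderiv m f f' -> pcont m f' ->
  nice k f -> nice k f' -> nice k (fun w => w m * f w) ->
  gint k (fun w => w m * f w) = gint k f'.
Proof.
elim: k m f f' => [//|k IH] [|m] f f' mk df cf' nf nf' nxf; last first.
  rewrite /=; apply: eq_Rintegral => t _; congr (_ * _).
  apply: (IH m (fun w => f (shift0 t w)) (fun w => f' (shift0 t w))) => //.
  - by move=> w s; have := df (shift0 t w) s; rewrite !upd_shiftS;
      under eq_fun do rewrite upd_shiftS.
  - by move=> w; have := cf' (shift0 t w); under eq_fun do rewrite upd_shiftS.
  - exact: nice_shift.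
  - exact: nice_shift.
  - exact: (nice_shift t nxf).
rewrite gint_first// gint_first//; apply: eq_gint => w /=.
case: nf nf' nxf => _ [C1 H1] [_ [C2 H2]] [_ [C3 H3]].
have [p1 p2 p3] := And3 (gdom_ge0 H1) (gdom_ge0 H2) (gdom_ge0 H3).
pose C := (C1 + C2 + C3) * expR (lam * wsum xpredT k w).
apply: (@stein1 _ (fun t => f (shift0 t w)) (fun t => f' (shift0 t w)) C).
- move=> t; have := df (shift0 0 w) t; rewrite upd_shift0.
  by under eq_fun do rewrite upd_shift0.
- by have := cf' (shift0 0 w); under eq_fun do rewrite upd_shift0.
- move=> t; apply: (gdom_line w (gdom_le _ H1)); lra.
- move=> t; apply: (gdom_line w (gdom_le _ H3)); lra.
- move=> t; apply: (gdom_line w (gdom_le _ H2)); lra.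
Qed.

Lemma pderiv_cont m f f' : pderiv m f f' -> pcont m f.
Proof. by move=> df w t; exact: is_derive_continuous (df w t). Qed.

Lemma pderiv_eq m f f' g' : pderiv m f f' -> f' =1 g' -> pderiv m f g'.
Proof. by move=> df /funext <-. Qed.

Lemma pderiv_cst m (c : R) : pderiv m (fun=> c) (fun=> 0).
Proof. by move=> w t; exact: is_derive_fcst. Qed.

Lemma pderiv_coord m i : pderiv m (fun w => w i) (fun=> (i == m)%:R).
Proof.
move=> w t; rewrite /upd; case: eqP => _; last exact: is_derive_fcst.
exact: is_derive_fid.
Qed.

Lemma pderivB m f g f' g' : pderiv m f f' -> pderiv m g g' ->
  pderiv m (fun w => f w - g w) (fun w => f' w - g' w).
Proof. by move=> df dg w t; exact: is_derive_fB. Qed.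

Lemma pderivM m f g f' g' : pderiv m f f' -> pderiv m g g' ->
  pderiv m (fun w => f w * g w) (fun w => f' w * g w + f w * g' w).
Proof. by move=> df dg w t; exact: is_derive_fM. Qed.

Lemma pderiv_exp m f f' : pderiv m f f' ->
  pderiv m (fun w => expR (f w)) (fun w => f' w * expR (f w)).
Proof. by move=> df w t; exact: is_derive_fexp. Qed.

Lemma pderivV m f f' : (forall w, f w != 0) -> pderiv m f f' ->
  pderiv m (fun w => (f w)^-1) (fun w => - f' w / f w ^+ 2).
Proof. by move=> f0 df w t; exact: (is_derive_fV (f0 _) (df w t)). Qed.

Lemma pderiv_sum m (J : Type) (s : seq J) (h h' : J -> (nat -> R) -> R) :
  (forall j, pderiv m (h j) (h' j)) ->
  pderiv m (fun w => \sum_(j <- s) h j w) (fun w => \sum_(j <- s) h' j w).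
Proof.
move=> dh w t.
by apply: (@is_derive_fsum R J s (fun j x => h j (upd w m x))
  (fun j => h' j (upd w m t))) => j; exact: dh.
Qed.

Lemma pcont_cst m (c : R) : pcont m (fun=> c).
Proof. by move=> w t; exact: cvg_cst. Qed.

Lemma pcontD m f g : pcont m f -> pcont m g -> pcont m (fun w => f w + g w).
Proof. by move=> cf cg w t; apply: cvgD; [exact: cf|exact: cg]. Qed.

Lemma pcontB m f g : pcont m f -> pcont m g -> pcont m (fun w => f w - g w).
Proof. by move=> cf cg w t; apply: cvgB; [exact: cf|exact: cg]. Qed.

Lemma pcontM m f g : pcont m f -> pcont m g -> pcont m (fun w => f w * g w).
Proof. by move=> cf cg w t; apply: cvgM; [exact: cf|exact: cg]. Qed.

End stein_coord.

(** * Polynomial growth and the first two Gaussian moments *)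

Section nice_examples.
Context {R : realType}.
Implicit Types (w : nat -> R) (k m : nat) (f g : (nat -> R) -> R).

Definition Ssum k w : R := 1 + wsum xpredT k w.

Lemma Ssum_ge1 k w : 1 <= Ssum k w.
Proof. by rewrite lerDl wsum_ge0. Qed.

(** Exponents add under multiplication, so the defining bound of [nice] is not preserved by
    products. Polynomial growth is, and it implies that bound. *)
Definition polyb k f := exists2 C : R, 0 <= C &
  exists m : nat, forall w, `|f w| <= C * Ssum k w ^+ m.

(* (1 + s)^m <= (m/c)^m e^c e^{c s}, obtained from 1 + x <= e^x. *)
Lemma poly_le_exp (c : R) m : 0 < c -> exists2 C : R, 0 < C &
  forall s : R, 0 <= s -> (1 + s) ^+ m <= C * expR (c * s).
Proof.
move=> c0; case: m => [|m].
  exists 1 => // s s0; rewrite expr0 mul1r -expR0 ler_expR mulr_ge0// ltW//.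
pose a : R := c / m.+1%:R.
have a0 : 0 < a by rewrite divr_gt0.
exists (a^-1 ^+ m.+1 * expR c); first by rewrite mulr_gt0 ?expR_gt0 ?exprn_gt0 ?invr_gt0.
move=> s s0.
rewrite -mulrA.
have -> : expR c * expR (c * s) = expR (a * (1 + s)) ^+ m.+1 :> R.
  rewrite -expRD -expRM_natl; congr expR; rewrite /a; field.
  by rewrite addrC natr1 pnatr_eq0.
rewrite -exprMn lerXn2r ?nnegrE ?addr_ge0// ?mulr_ge0 ?expR_ge0 ?invr_ge0 ?(ltW a0)//.
rewrite mulrC ler_pdivlMr// mulrC.
by apply: le_trans (expR_ge1Dx _); rewrite lerDr.
Qed.

Lemma polyb_nice k f : smeas f -> polyb k f -> nice k f.
Proof.
move=> mf [C C0 [m fC]]; split => //.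
have [D D0 HD] := @poly_le_exp lam m ltac:(by rewrite divr_gt0).
exists (C * D) => w; apply: (le_trans (fC w)).
by rewrite -mulrA ler_wpM2l// HD// wsum_ge0.
Qed.

Lemma polyb_coord k i : (i < k)%N -> polyb k (fun w => w i : R).
Proof.
move=> ik; exists 1 => //; exists 1%N => w; rewrite mul1r expr1.
have H : w i ^+ 2 <= wsum xpredT k w.
  rewrite /wsum (bigD1 (Ordinal ik))//= mul1r lerDl.
  by apply: sumr_ge0 => j _; rewrite mul1r sqr_ge0.
rewrite /Ssum; move: H; rewrite -real_normK ?num_real//.
by have := sqr_ge0 (`|w i| - 1); nra.
Qed.

Lemma polybM k f g : polyb k f -> polyb k g -> polyb k (fun w => f w * g w).
Proof.
move=> [C C0 [m fC]] [D D0 [n gD]]; exists (C * D); first exact: mulr_ge0.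
exists (m + n)%N => w; rewrite normrM exprD mulrACA.
exact: ler_pM.
Qed.

(** Stein's identity for the constant function 1, whose derivative is 0. *)
Lemma gint_coord k m : (m < k)%N -> gint k (fun w => w m) = 0 :> R.
Proof.
move=> mk; rewrite -(@gint_cst R k 0).
rewrite -(@stein R k m (fun=> 1) (fun=> 0))//.
- by apply: eq_gint => w; rewrite mulr1.
- exact: pderiv_cst.
- exact: pcont_cst.
- exact: nice_cst.
- exact: nice_cst.
- under eq_fun do rewrite mulr1.
  by apply: polyb_nice; [exact: smeas_coord|exact: polyb_coord].
Qed.

Lemma nice_coord2 k l m : (l < k)%N -> (m < k)%N -> nice k (fun w => w l * w m).
Proof.
move=> lk mk; apply: polyb_nice; first by apply: smeasM; exact: smeas_coord.
by apply: polybM; exact: polyb_coord.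
Qed.

Lemma nice_coord k m : (m < k)%N -> nice k (fun w => w m).
Proof.
by move=> mk; apply: polyb_nice; [exact: smeas_coord|exact: polyb_coord].
Qed.

(** The Kronecker symbol is the derivative of one coordinate along another, by Stein's identity. *)
Lemma gint_coord2 k l m : (l < k)%N -> (m < k)%N ->
  gint k (fun w => w l * w m) = (l == m)%:R :> R.
Proof.
move=> lk mk; rewrite (@stein R k l (fun w => w m) (fun=> (m == l)%:R))//.
- by rewrite gint_cst eq_sym.
- exact: pderiv_coord.
- exact: pcont_cst.
- exact: nice_coord.
- exact: nice_cst.
- exact: nice_coord2.
Qed.

End nice_examples.

(** * Softmax weights in standard Gaussian coordinates *)

Section softmax.
Context {R : realType}.
Variables (d q : nat) (dq : (d <= q)%N) (K : 'M[R]_d).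
Implicit Types (w : nat -> R) (n i j l m : nat) (b c : 'I_d).

(* Sample j is the block of coordinates j q, ..., j q + q - 1 of w, whose first
   d entries are g_j = Sigma^{-1/2} x_j and whose last q - d entries are the
   noise.  With K = Sigma^{1/2} B Sigma^{1/2}, [uu i] is u = K^T g_i, [pr n i j]
   is the attention weight p_j of query i on key j, and [Gv n i] is the
   attention output in the g-coordinates. *)
Definition sqn j w : R := \sum_(l < q) w (j * q + l)%N ^+ 2.
Definition uu i b w : R := \sum_(a < d) K a b * w (i * q + a)%N.
Definition ell i j w : R := \sum_(b < d) uu i b w * w (j * q + b)%N.
Definition wt i j w : R := expR (ell i j w).
Definition Dn n i w : R := \sum_(j < n) wt i j w.
Definition pr n i j w : R := wt i j w * (Dn n i w)^-1.
Definition Gv n i b w : R := \sum_(j < n) pr n i j w * w (j * q + b)%N.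
(** One quantity dominating both 1 and every coordinate of block [j]; its attention average [Av]
    then dominates [Gv]. *)
Definition Psi j w : R := 1 + sqn j w.
Definition Av n i w : R := \sum_(l < n) pr n i l w * Psi l w.
(** The covariance of the keys under the weights of query [i]. Centring one factor is enough, since
    the centred keys have weighted mean 0. *)
Definition Cov n i b c w : R :=
  \sum_(j < n) pr n i j w * (w (j * q + b)%N * (w (j * q + c)%N - Gv n i c w)).

Lemma Dn_gt0 n i w : (0 < n)%N -> 0 < Dn n i w.
Proof.
case: n => // n _; rewrite /Dn big_ord_recl ltr_pwDl ?expR_gt0//.
by apply: sumr_ge0 => j _; exact: expR_ge0.
Qed.

Lemma Dn_ge0 n i w : 0 <= Dn n i w.
Proof. by apply: sumr_ge0 => j _; exact: expR_ge0. Qed.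

Lemma pr_ge0 n i j w : 0 <= pr n i j w.
Proof. by rewrite mulr_ge0 ?expR_ge0 ?invr_ge0 ?Dn_ge0. Qed.

Lemma pr_gt0 n i j w : (0 < n)%N -> 0 < pr n i j w.
Proof. by move=> n0; rewrite mulr_gt0 ?expR_gt0 ?invr_gt0 ?Dn_gt0. Qed.

Lemma sum_pr n i w : (0 < n)%N -> \sum_(j < n) pr n i j w = 1.
Proof. by move=> n0; rewrite -mulr_suml divff// gt_eqF// Dn_gt0. Qed.

Lemma pr_le1 n i j w : (j < n)%N -> pr n i j w <= 1.
Proof.
move=> jn; rewrite -(sum_pr i w (leq_ltn_trans (leq0n _) jn)).
rewrite (bigD1 (Ordinal jn))//= lerDl.
by apply: sumr_ge0 => l _; exact: pr_ge0.
Qed.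

Lemma sqn_ge0 j w : 0 <= sqn j w.
Proof. by apply: sumr_ge0 => l _; exact: sqr_ge0. Qed.

Lemma Psi_ge1 j w : 1 <= Psi j w. Proof. by rewrite lerDl sqn_ge0. Qed.

Lemma Psi_ge0 j w : 0 <= Psi j w. Proof. exact: le_trans ler01 (Psi_ge1 _ _). Qed.

Lemma Av_ge1 n i w : (0 < n)%N -> 1 <= Av n i w.
Proof.
move=> n0; rewrite -(sum_pr i w n0); apply: ler_sum => l _.
by rewrite ler_peMr ?pr_ge0 ?Psi_ge1.
Qed.

Lemma coord_le_Psi j l w : (l < q)%N -> `|w (j * q + l)%N| <= Psi j w.
Proof.
move=> lq; have H : w (j * q + l)%N ^+ 2 <= sqn j w.
  rewrite /sqn (bigD1 (Ordinal lq))//= lerDl.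
  by apply: sumr_ge0 => *; exact: sqr_ge0.
rewrite /Psi; move: H; rewrite -real_normK ?num_real//.
by have := sqr_ge0 (`|w (j * q + l)%N| - 1); nra.
Qed.

Lemma ordd_lt b : (b < q)%N. Proof. exact: leq_trans (ltn_ord b) dq. Qed.

Lemma Gv_le_Av n i b w : `|Gv n i b w| <= Av n i w.
Proof.
apply: (le_trans (ler_norm_sum _ _ _)); apply: ler_sum => l _.
by rewrite normrM (ger0_norm (pr_ge0 _ _ _ _)) ler_wpM2l ?pr_ge0// coord_le_Psi// ordd_lt.
Qed.

(** Block and offset are quotient and remainder of the division by [q]. *)
Lemma idx_eq i j a b : (a < q)%N -> (b < q)%N ->
  ((i * q + a)%N == (j * q + b)%N) = (i == j) && (a == b).
Proof.
move=> aq bq; have q0 : (0 < q)%N by exact: leq_ltn_trans aq.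
apply/eqP/andP => [E|[/eqP-> /eqP->]//].
have := congr1 (modn^~ q) E; rewrite /= !modnMDl !modn_small// => ->.
have := congr1 (divn^~ q) E; rewrite /= !divnMDl// !divn_small// !addn0 => ->.
by [].
Qed.

Lemma idx_lt n j l : (j < n)%N -> (l < q)%N -> (j * q + l < n * q)%N.
Proof.
move=> jn lq; apply: (@leq_trans (j.+1 * q)); last by rewrite leq_mul2r jn orbT.
by rewrite mulSn addnC ltn_add2r.
Qed.

Lemma smeas_uu i b : smeas (uu i b).
Proof.
apply: smeas_sum => a; apply: smeasM; [exact: smeas_cst|exact: smeas_coord].
Qed.

Lemma smeas_wt i j : smeas (wt i j).
Proof.
apply: smeas_expR; apply: smeas_sum => b.
by apply: smeasM; [exact: smeas_uu|exact: smeas_coord].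
Qed.

Lemma smeas_pr n i j : (0 < n)%N -> smeas (pr n i j).
Proof.
move=> n0; apply: smeasM; first exact: smeas_wt.
apply: smeasV; first by move=> w; exact: Dn_gt0.
by apply: smeas_sum => l; exact: smeas_wt.
Qed.

Lemma smeas_Gv n i b : (0 < n)%N -> smeas (Gv n i b).
Proof.
move=> n0; apply: smeas_sum => j.
by apply: smeasM; [exact: smeas_pr|exact: smeas_coord].
Qed.

(** * Partial derivatives in a key different from the query, along which [uu i] is constant *)

Section derivatives.
Variables (n i j : nat) (ji : j != i) (jn : (j < n)%N) (b : 'I_d).
Let m := (j * q + b)%N.

Lemma pderiv_block l : (l < q)%N -> pderiv m (fun w => w (i * q + l)%N : R) (fun=> 0).
Proof.
move=> lq; apply: pderiv_eq (pderiv_coord _ _) _ => w.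
by rewrite idx_eq ?ordd_lt// eq_sym (negbTE ji).
Qed.

Lemma pderiv_uu c : pderiv m (uu i c) (fun=> 0).
Proof.
apply: pderiv_eq; first apply: pderiv_sum => a.
  by apply: pderivM; [exact: pderiv_cst|apply: pderiv_block; exact: ordd_lt].
by move=> w /=; apply: big1 => a _; rewrite mul0r mulr0 addr0.
Qed.

Lemma pderiv_ell l : pderiv m (ell i l) (fun w => (l == j)%:R * uu i b w).
Proof.
apply: pderiv_eq; first apply: pderiv_sum => c.
  by apply: pderivM; [exact: pderiv_uu|exact: pderiv_coord].
move=> w /=; rewrite (eq_bigr (fun c : 'I_d => (l == j)%:R * (uu i c w * (c == b)%:R))).
  rewrite -mulr_sumr (bigD1 b)//= eqxx mulr1 big1 ?addr0// => c /negbTE.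
  by move=> ->; rewrite mulr0.
move=> c _; rewrite mul0r add0r idx_eq ?ordd_lt// -mulnb natrM.
by rewrite mulrCA.
Qed.

Lemma pderiv_wt l : pderiv m (wt i l) (fun w => (l == j)%:R * uu i b w * wt i l w).
Proof. exact: pderiv_exp (pderiv_ell l). Qed.

Lemma pderiv_Dn : pderiv m (Dn n i) (fun w => uu i b w * wt i j w).
Proof.
apply: pderiv_eq; first by apply: pderiv_sum => l; exact: pderiv_wt.
move=> w /=; rewrite (bigD1 (Ordinal jn))//= eqxx mul1r big1 ?addr0// => l.
by rewrite -val_eqE/= => /negbTE ->; rewrite !mul0r.
Qed.

Lemma pderiv_pr l : pderiv m (pr n i l)
  (fun w => uu i b w * pr n i l w * ((l == j)%:R - pr n i j w)).
Proof.
have n0 : (0 < n)%N by exact: leq_ltn_trans jn.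
have D0 w : Dn n i w != 0 by rewrite gt_eqF// Dn_gt0.
apply: pderiv_eq; first exact: pderivM (pderiv_wt l) (pderivV D0 pderiv_Dn).
by move=> w /=; rewrite /pr; have := D0 w; set D := Dn n i w => D0'; field.
Qed.

(** The attention output depends on key [j] only through terms weighted by [pr n i j], so this
    weight factors out. It is the shape in which a derivative counts as an error term below. *)
Lemma pderiv_Gv c : pderiv m (Gv n i c)
  (fun w => pr n i j w * ((b == c)%:R + uu i b w * (w (j * q + c)%N - Gv n i c w))).
Proof.
apply: pderiv_eq; first apply: pderiv_sum => l.
  by apply: pderivM; [exact: pderiv_pr|exact: pderiv_coord].
move=> w /=.
rewrite (eq_bigr (fun l : 'I_n => (val l == j)%:R * (uu i b w * pr n i l w * w (l * q + c)%N +
   pr n i l w * (b == c)%:R) -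
   uu i b w * pr n i j w * (pr n i l w * w (l * q + c)%N))).
  rewrite sumrB -mulr_sumr (bigD1 (Ordinal jn))//= eqxx big1 ?addr0.
    by rewrite mul1r -/(Gv n i c w); ring.
  by move=> l; rewrite -val_eqE/= => /negbTE ->; rewrite mul0r.
move=> l _; rewrite idx_eq ?ordd_lt// -mulnb natrM [(_ == b :> nat)]eq_sym.
by rewrite val_eqE; ring.
Qed.

End derivatives.

End softmax.

(** * Products of three weights and families of polynomial growth *)

Section softmax_bounds.
Context {R : realType}.
Variables (d q : nat) (dq : (d <= q)%N) (K : 'M[R]_d).
Implicit Types (w : nat -> R) (n i j l m : nat) (b c : 'I_d).
Local Notation sqn := (sqn q).
Local Notation uu := (uu q K).
Local Notation ell := (ell q K).
Local Notation wt := (wt q K).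
Local Notation pr := (pr q K).
Local Notation Gv := (Gv q K).
Local Notation Psi := (Psi q).
Local Notation Av := (Av q K).
Hypothesis ell_le : forall i j w, `|ell i j w| <= (sqn i w + sqn j w) / 32.

(* Sum of the tangent bounds y^-3 >= 4 - 3 y at y = n p_k. *)
Lemma sum_pr_inv3 n i w : (0 < n)%N ->
  n%:R ^+ 4 <= \sum_(k < n) (pr n i k w)^-1 ^+ 3.
Proof.
move=> n0; have nn0 : 0 < n%:R :> R by rewrite ltr0n.
apply: (@le_trans _ _ (\sum_(k < n) (4 * n%:R ^+ 3 - 3 * n%:R ^+ 4 * pr n i k w))).
  rewrite sumrB sumr_const card_ord -mulr_sumr sum_pr// mulr1 -[X in X - _]mulr_natr.
  by rewrite [leRHS](_ : _ = n%:R ^+ 4)//; ring.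
apply: ler_sum => k _; have := pr_gt0 q K i k w n0; set x := pr n i k w => x0.
set y := n%:R * x; have y0 : 0 < y by rewrite mulr_gt0.
rewrite -subr_ge0 (_ : _ - _ = n%:R ^+ 3 * ((y - 1) ^+ 2 * (3 * y ^+ 2 + 2 * y + 1)) / y ^+ 3).
  rewrite divr_ge0 ?exprn_ge0 ?(ltW y0)// mulr_ge0 ?exprn_ge0 ?(ltW nn0)//.
  rewrite mulr_ge0 ?sqr_ge0//; nra.
by rewrite /y; field; rewrite !gt_eqF.
Qed.

Definition Elam j w : R := expR (lam * sqn j w).

(** The exponent is at most [lam] times the largest [s]. The aim is decoupling: every term on the
    right involves a single sample. *)
Lemma expR_le_sum5 (a1 a2 a3 a4 a5 : R) (s1 s2 s3 s4 s5 : R) :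
  0 <= a1 -> 0 <= a2 -> 0 <= a3 -> 0 <= a4 -> 0 <= a5 ->
  0 <= s1 -> 0 <= s2 -> 0 <= s3 -> 0 <= s4 -> 0 <= s5 ->
  a1 + a2 + a3 + a4 + a5 <= lam ->
  expR (a1 * s1 + a2 * s2 + a3 * s3 + a4 * s4 + a5 * s5) <=
  expR (lam * s1) + expR (lam * s2) + expR (lam * s3) + expR (lam * s4) + expR (lam * s5).
Proof.
move=> a10 a20 a30 a40 a50 s10 s20 s30 s40 s50 al.
pose s := Num.max s1 (Num.max s2 (Num.max s3 (Num.max s4 s5))).
have [h1 h2 h3 h4 h5] : [/\ s1 <= s, s2 <= s, s3 <= s, s4 <= s & s5 <= s].
  by rewrite /s !le_max !lexx !orbT.
have s0 : 0 <= s by exact: le_trans h1.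
apply: (@le_trans _ _ (expR (lam * s))).
  rewrite ler_expR.
  apply: (@le_trans _ _ ((a1 + a2 + a3 + a4 + a5) * s)); last exact: ler_wpM2r.
  by rewrite !mulrDl !lerD// ler_wpM2l.
have e1 := expR_gt0 (lam * s1); have e2 := expR_gt0 (lam * s2).
have e3 := expR_gt0 (lam * s3); have e4 := expR_gt0 (lam * s4).
have e5 := expR_gt0 (lam * s5).
have : [|| s == s1, s == s2, s == s3, s == s4 | s == s5].
  rewrite /s; do 4 (case: leP => _; rewrite ?eqxx ?orbT//).
by move=> /orP[/eqP ->|/or4P[] /eqP ->]; lra.
Qed.

(** The inequality [sum_pr_inv3] is multiplied by the three weights. In each quotient p_a p_b p_c /
    p_k^3 the normalizing sums cancel and only logits remain. The extra exponential in samples [i],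
    [a], [c] is reserved for polynomial factors. *)
Lemma pr3_le n i (a b c : nat) w : (0 < n)%N ->
  pr n i a w * pr n i b w * pr n i c w *
    expR ((sqn i w + sqn a w + sqn c w) / 64) <=
  n%:R ^- 4 * \sum_(k < n) (Elam i w + Elam a w + Elam b w + Elam c w + Elam k w).
Proof.
move=> n0; have nn0 : 0 < n%:R ^+ 4 :> R by rewrite exprn_gt0// ltr0n.
rewrite mulrC ler_pdivlMl//.
have := sum_pr_inv3 i w n0; set e := expR _; set P := pr n i a w * _ * _.
have P0 : 0 <= P by apply: mulr_ge0; [apply: mulr_ge0|]; exact: pr_ge0.
move=> H; apply: (@le_trans _ _ (e * (P * \sum_(k < n) (pr n i k w)^-1 ^+ 3))).
  by rewrite mulrCA ler_wpM2l ?expR_ge0// mulrC ler_wpM2l.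
rewrite !mulr_sumr; apply: ler_sum => k _.
have -> : P * (pr n i k w)^-1 ^+ 3 =
    expR (ell i a w + ell i b w + ell i c w - 3 * ell i k w).
  rewrite /P /pr /wt !expRD expRN -[3 * _]mulrC -[3]/(3%:R) expRM_natr.
  have Dp := Dn_gt0 q K i w n0; have wp := expR_gt0 (ell i k w).
  by field; rewrite !gt_eqF// ?mulr_gt0 ?invr_gt0.
rewrite /e -expRD.
have [h1 h2 h3 h4] := And4 (ell_le i a w) (ell_le i b w) (ell_le i c w) (ell_le i k w).
move: h1 h2 h3 h4; rewrite !ler_norml => /andP[_ h1] /andP[_ h2] /andP[_ h3] /andP[h4 _].
(* The logits contribute 12, 2, 2, 2, 6 and the extra factor 1, 1, 0, 1, 0, all over 64. The total
   27/64 stays below [lam], which is 28/64. *)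
apply: (@le_trans _ _ (expR (13/64 * sqn i w + 3/64 * sqn a w + 2/64 * sqn b w +
    3/64 * sqn c w + 6/64 * sqn k w))).
  by rewrite ler_expR; lra.
by apply: expR_le_sum5; rewrite ?sqn_ge0 ?divr_ge0// /lam; lra.
Qed.

(** After multiplying the inequality for [m] by [x], its distance to the next one is
    [m.+1%:R * y ^+ m * (x - y) ^+ 2]. *)
Lemma tangent_pow m (x y : R) : 0 <= x -> 0 <= y ->
  y ^+ m.+1 + m.+1%:R * y ^+ m * (x - y) <= x ^+ m.+1.
Proof.
move=> x0 y0; elim: m => [|m IH]; first by rewrite expr0 !expr1; lra.
rewrite [leRHS]exprS; apply: le_trans (ler_wpM2l x0 IH).
rewrite -subr_ge0 [leRHS](_ : _ = m.+1%:R * y ^+ m * (x - y) ^+ 2).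
  by apply: mulr_ge0; [apply: mulr_ge0; [exact: ler0n|exact: exprn_ge0]|exact: sqr_ge0].
by rewrite !exprS -[m.+2%:R]natr1; ring.
Qed.

(** Jensen's inequality: tangents at the mean are averaged with the softmax weights, and the linear
    terms cancel. *)
Lemma Av_pow_le n i m w : (0 < n)%N ->
  Av n i w ^+ m.+1 <= \sum_(l < n) pr n i l w * Psi l w ^+ m.+1.
Proof.
move=> n0; have A0 : 0 <= Av n i w by exact: le_trans ler01 (Av_ge1 _ _ _ _ n0).
apply: (@le_trans _ _ (\sum_(l < n) pr n i l w *
   (Av n i w ^+ m.+1 + m.+1%:R * Av n i w ^+ m * (Psi l w - Av n i w)))); last first.
  apply: ler_sum => l _; rewrite ler_wpM2l ?pr_ge0//.
  by apply: tangent_pow => //; exact: Psi_ge0.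
rewrite (eq_bigr (fun l : 'I_n => pr n i l w * (Av n i w ^+ m.+1 - m.+1%:R * Av n i w ^+ m * Av n i w) +
    m.+1%:R * Av n i w ^+ m * (pr n i l w * Psi l w))); last by move=> l _; ring.
by rewrite big_split/= -mulr_suml -mulr_sumr sum_pr// -/(Av n i w); lra.
Qed.

(** The average [Av] stays a factor of its own, because replacing it by individual norms would bring
    in all n samples. *)
Definition Bd n i j w : R := Psi i w * Psi j w * Av n i w.

Lemma Bd_ge1 n i j w : (0 < n)%N -> 1 <= Bd n i j w.
Proof.
move=> n0; rewrite /Bd -[1]mulr1; apply: ler_pM => //; last exact: Av_ge1.
by rewrite -[1]mulr1; apply: ler_pM => //; exact: Psi_ge1.
Qed.

Definition family := nat -> nat -> nat -> (nat -> R) -> R.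

(** Constant and degree do not depend on n, i, j; this uniformity is what the rates rest on. *)
Definition fam (f : family) :=
  (exists2 C : R, 0 <= C & exists m, forall n i j w, (i < n)%N -> (j < n)%N ->
     `|f n i j w| <= C * Bd n i j w ^+ m) /\
  (forall n i j, (i < n)%N -> (j < n)%N -> smeas (f n i j)).

Lemma Bd_exp_le n i j w m1 m2 : (i < n)%N -> (m1 <= m2)%N ->
  Bd n i j w ^+ m1 <= Bd n i j w ^+ m2.
Proof. by move=> /(leq_ltn_trans (leq0n _)) n0 ?; rewrite ler_weXn2l// Bd_ge1. Qed.

Lemma fam_cst (c : R) : fam (fun n i j w => c).
Proof.
split; last by move=> *; exact: smeas_cst.
by exists `|c| => //; exists 0 => *; rewrite mulr1.
Qed.

Lemma famD f g : fam f -> fam g -> fam (fun n i j w => f n i j w + g n i j w).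
Proof.
move=> [[C C0 [m fC]] mf] [[D D0 [m' gD]] mg].
split; last by move=> *; apply: smeasD; [exact: mf|exact: mg].
exists (C + D); first exact: addr_ge0.
exists (m + m')%N => n i j w iin jn; rewrite (le_trans (ler_normD _ _))// mulrDl.
apply: lerD; [apply: (le_trans (fC n i j w iin jn))|apply: (le_trans (gD n i j w iin jn))];
  by rewrite ler_wpM2l// Bd_exp_le// ?leq_addr ?leq_addl.
Qed.

Lemma famM f g : fam f -> fam g -> fam (fun n i j w => f n i j w * g n i j w).
Proof.
move=> [[C C0 [m fC]] mf] [[D D0 [m' gD]] mg].
split; last by move=> *; apply: smeasM; [exact: mf|exact: mg].
exists (C * D); first exact: mulr_ge0.
exists (m + m')%N => n i j w iin jn; rewrite normrM exprD mulrACA.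
by apply: ler_pM => //; [exact: fC|exact: gD].
Qed.

Lemma famB f g : fam f -> fam g -> fam (fun n i j w => f n i j w - g n i j w).
Proof.
move=> ff fg; have := famD ff (famM (fam_cst (-1)) fg).
rewrite (_ : (fun n i j w => _) = (fun n i j w => f n i j w - g n i j w))//.
by do 4 (apply/funext => ?); rewrite mulN1r.
Qed.

Lemma fam_sum (J : Type) (s : seq J) (h : J -> family) :
  (forall x, fam (h x)) -> fam (fun n i j w => \sum_(x <- s) h x n i j w).
Proof.
move=> fh; elim: s => [|x s IH].
  rewrite (_ : (fun n i j w => _) = (fun n i j w => 0)); first exact: fam_cst.
  by do 4 (apply/funext => ?); rewrite big_nil.
rewrite (_ : (fun n i j w => _) =
    (fun n i j w => h x n i j w + \sum_(x <- s) h x n i j w)); first exact: famD.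
by do 4 (apply/funext => ?); rewrite big_cons.
Qed.

Lemma fam_le1 f : (forall n i j w, (i < n)%N -> (j < n)%N -> `|f n i j w| <= Bd n i j w) ->
  (forall n i j, (i < n)%N -> (j < n)%N -> smeas (f n i j)) -> fam f.
Proof.
move=> fB mf; split => //; exists 1 => //; exists 1%N => n i j w iin jn.
by rewrite mul1r expr1 fB.
Qed.

Lemma fam_coordi l : (l < q)%N -> fam (fun n i j w => w (i * q + l)%N).
Proof.
move=> lq; apply: fam_le1 => [n i j w iin jn|*]; last exact: smeas_coord.
have n0 : (0 < n)%N by exact: leq_ltn_trans iin.
apply: (le_trans (coord_le_Psi _ _ lq)); rewrite /Bd -mulrA ler_peMr ?Psi_ge0//.
by rewrite -[1]mulr1; apply: ler_pM => //; [exact: Psi_ge1|exact: Av_ge1].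
Qed.

Lemma fam_coordj l : (l < q)%N -> fam (fun n i j w => w (j * q + l)%N).
Proof.
move=> lq; apply: fam_le1 => [n i j w iin jn|*]; last exact: smeas_coord.
have n0 : (0 < n)%N by exact: leq_ltn_trans iin.
apply: (le_trans (coord_le_Psi _ _ lq)); rewrite /Bd mulrAC ler_peMl ?Psi_ge0//.
by rewrite -[1]mulr1; apply: ler_pM => //; [exact: Psi_ge1|exact: Av_ge1].
Qed.

Lemma fam_uu b : fam (fun n i j w => uu i b w).
Proof.
apply: (@fam_sum _ _ (fun a n i j w => K a b * w (i * q + a)%N)) => a.
by apply: famM; [exact: fam_cst|apply: fam_coordi; exact: ordd_lt].
Qed.

Lemma fam_Gv b : fam (fun n i j w => Gv n i b w).
Proof.
apply: fam_le1 => n i j; last by move=> /(leq_ltn_trans (leq0n _)) n0 _; exact: smeas_Gv.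
move=> w iin jn; apply: (le_trans (Gv_le_Av _ _ _ _ _ _)) => //.
have n0 : (0 < n)%N by exact: leq_ltn_trans iin.
rewrite /Bd ler_peMl//; first exact: le_trans ler01 (Av_ge1 _ _ _ _ n0).
by rewrite -[1]mulr1; apply: ler_pM => //; exact: Psi_ge1.
Qed.

Lemma fam_pr : fam (fun n i j w => pr n i j w).
Proof.
apply: fam_le1 => n i j; last by move=> /(leq_ltn_trans (leq0n _)) n0 _; exact: smeas_pr.
move=> w iin jn; have n0 : (0 < n)%N by exact: leq_ltn_trans iin.
by rewrite ger0_norm ?pr_ge0// (le_trans (pr_le1 _ _ _ _ jn))// Bd_ge1.
Qed.

Lemma wsum_block (I : nat -> bool) n j w : (j < n)%N ->
  (forall l, (j * q <= l < j * q + q)%N -> I l) ->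
  sqn j w <= wsum I (n * q) w.
Proof.
move=> jn HI; have le2 : (j * q + q <= n * q)%N by rewrite -mulSnr leq_mul2r jn orbT.
rewrite /sqn /wsum -(big_mkord xpredT (fun l => (I l)%:R * w l ^+ 2)).
rewrite (@big_cat_nat _ _ _ (j * q)) ?(leq_trans (leq_addr q _) le2)//=.
rewrite (@big_cat_nat _ _ _ (j * q + q) (j * q))//= ?leq_addr//.
rewrite -[leLHS]add0r; apply: lerD.
  by apply: sumr_ge0 => l _; rewrite mulr_ge0 ?ler0n ?sqr_ge0.
rewrite -[leLHS]addr0; apply: lerD; last first.
  by apply: sumr_ge0 => l _; rewrite mulr_ge0 ?ler0n ?sqr_ge0.
rewrite [leRHS](_ : _ = \sum_(0 <= l < q) (I (l + j * q)%N)%:R * w (l + j * q)%N ^+ 2); last first.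
  by rewrite -{1}[(j * q)%N]add0n big_addn addKn.
rewrite -(big_mkord xpredT (fun l => w (j * q + l)%N ^+ 2)).
rewrite !big_seq; apply: ler_sum => l; rewrite mem_index_iota => /andP[_ lq].
by rewrite [(j * q + l)%N]addnC HI ?mul1r// leq_addl/= addnC ltn_add2l.
Qed.

Lemma Psi_le_Ssum n i w : (i < n)%N -> Psi i w <= Ssum (n * q) w.
Proof. by move=> iin; rewrite lerD2l wsum_block. Qed.

(** Each of the three factors of [Bd] is at most [Ssum (n * q)], hence the degree [3 * m]. This is
    too crude for rates but gives integrability. *)
Lemma fam_nice f n i j : (i < n)%N -> (j < n)%N -> fam f -> nice (n * q) (f n i j).
Proof.
move=> iin jn [[C C0 [m fC]] mf]; apply: polyb_nice; first exact: mf.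
have n0 : (0 < n)%N by exact: leq_ltn_trans iin.
have S0 w : 0 <= Ssum (n * q) w by exact: le_trans ler01 (Ssum_ge1 _ _).
exists C => //; exists (3 * m)%N => w; apply: (le_trans (fC n i j w iin jn)).
rewrite ler_wpM2l// exprM lerXn2r// ?nnegrE ?exprn_ge0//.
  exact: le_trans ler01 (Bd_ge1 _ _ _ n0).
rewrite /Bd !exprSr expr0 mul1r; apply: ler_pM; rewrite ?mulr_ge0 ?Psi_ge0//.
- exact: le_trans ler01 (Av_ge1 _ _ _ _ n0).
- by apply: ler_pM; rewrite ?Psi_ge0// Psi_le_Ssum.
rewrite -[leRHS]mul1r -(sum_pr q K i w n0) mulr_suml; apply: ler_sum => l _.
by rewrite ler_wpM2l ?pr_ge0// Psi_le_Ssum.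
Qed.

End softmax_bounds.

(** * Error rates, and Stein's identity summed over the keys *)

Section softmax_errors.
Context {R : realType}.
Variables (d q : nat) (dq : (d <= q)%N) (K : 'M[R]_d).
Implicit Types (w : nat -> R) (n i j l m : nat) (b c : 'I_d).
Local Notation sqn := (@sqn R q).
Local Notation uu := (uu q K).
Local Notation ell := (ell q K).
Local Notation pr := (pr q K).
Local Notation Psi := (@Psi R q).
Local Notation fam := (fam q K).
Local Notation Elam := (@Elam R q).
Hypothesis ell_le : forall i j w, `|ell i j w| <= (sqn i w + sqn j w) / 32.

Lemma smeas_Elam j : smeas (Elam j).
Proof.
apply: smeas_expR; apply: smeasM; first exact: smeas_cst.
by apply: smeas_sum => l; apply: smeasX; exact: smeas_coord.
Qed.

Definition blk j l := (j * q <= l < j * q + q)%N.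

Lemma gdom_Elam (I : nat -> bool) n j : (j < n)%N -> (forall l, blk j l -> I l) ->
  gdom I 1 (n * q) (Elam j).
Proof.
move=> jn HI w; rewrite ger0_norm ?expR_ge0// mul1r ler_expR ler_wpM2l ?divr_ge0//.
exact: wsum_block.
Qed.

Lemma nice_Elam n j : (j < n)%N -> nice (n * q) (Elam j).
Proof. by move=> jn; split; [exact: smeas_Elam|exists 1; exact: gdom_Elam]. Qed.

Lemma Kprod_blk n j : (j < n)%N -> Kprod (blk j) (n * q) = Kexp ^+ q :> R.
Proof.
move=> jn; have le2 : (j * q + q <= n * q)%N by rewrite -mulSnr leq_mul2r jn orbT.
rewrite /Kprod -(big_mkord xpredT (fun l => if blk j l then Kexp else 1)).
rewrite (@big_cat_nat _ _ _ (j * q)) ?(leq_trans (leq_addr q _) le2)//=.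
rewrite (@big_cat_nat _ _ _ (j * q + q) (j * q))//= ?leq_addr//.
rewrite (eq_big_nat _ _ (F2 := fun=> 1)) => [|l /andP[_ lj]]; last first.
  by rewrite /blk leqNgt lj.
rewrite [X in _ * (_ * X)](eq_big_nat _ _ (F2 := fun=> 1)) => [|l /andP[lj _]]; last first.
  by rewrite /blk [(l < _)%N]ltnNge lj andbF.
rewrite [X in _ * (X * _)](eq_big_nat _ _ (F2 := fun=> Kexp)) => [|l lj]; last first.
  by rewrite /blk lj.
by rewrite !big1_eq mul1r mulr1 big_const_nat addKn iter_mulr_1.
Qed.

(** Only the [q] coordinates of block [j] cost a factor [Kexp], so the bound is free of n. *)
Lemma gint_Elam n j : (j < n)%N -> gint (n * q) (Elam j) <= Kexp ^+ q.
Proof.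
move=> jn; apply: (le_trans (ler_norm _)).
have := gint_bound (smeas_Elam j) (gdom_Elam jn (fun l H => H)).
by rewrite mul1r Kprod_blk.
Qed.

(** The bound of [pr3_le]: a factor n^-4 and n summands with bounded expectation, hence order
    n^-3. *)
Definition Zf n i (a b c : nat) w : R :=
  n%:R ^- 4 * \sum_(k < n) (Elam i w + Elam a w + Elam b w + Elam c w + Elam k w).

Lemma nice_Zf n i (a b c : nat) : (i < n)%N -> (a < n)%N -> (b < n)%N -> (c < n)%N ->
  nice (n * q) (Zf n i a b c).
Proof.
move=> iin an bn cn; apply: niceZ; apply: nice_sum => k.
by do 4 (apply: niceD; last exact: nice_Elam); exact: nice_Elam.
Qed.

Lemma gint_Zf n i (a b c : nat) : (i < n)%N -> (a < n)%N -> (b < n)%N -> (c < n)%N ->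
  gint (n * q) (Zf n i a b c) <= 5 * Kexp ^+ q / n%:R ^+ 3.
Proof.
move=> iin an bn cn; have n0 : (0 < n)%N by exact: leq_ltn_trans iin.
have nn0 : 0 < n%:R :> R by rewrite ltr0n.
have nE k : (k < n)%N -> nice (n * q) (Elam k) by exact: nice_Elam.
have n2 k : (k < n)%N -> nice (n * q) (fun w => Elam i w + Elam a w + Elam b w + Elam c w + Elam k w).
  by move=> kn; do 4 (apply: niceD; last exact: nE); exact: nE.
rewrite gintZ; last by apply: nice_sum => k; exact: n2.
rewrite gint_sum; last by move=> k; exact: n2.
apply: (@le_trans _ _ (n%:R ^- 4 * \sum_(k < n) (5 * Kexp ^+ q))).
  apply: ler_wpM2l; first by rewrite invr_ge0 exprn_ge0.
  apply: ler_sum => k _; rewrite !gintD//; try by repeat apply: niceD; apply: nE.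
  have [H1 H2 H3 H4] := And4 (gint_Elam iin) (gint_Elam an) (gint_Elam bn) (gint_Elam cn).
  have H5 := gint_Elam (ltn_ord k); lra.
rewrite sumr_const card_ord -[X in _ * X]mulr_natr le_eqVlt; apply/orP; left; apply/eqP.
by field; rewrite gt_eqF.
Qed.

(** Jensen's inequality exchanges a power of [Av] for one more weight, and each of the three
    remaining powers of [Psi] is absorbed by an exponential of rate 1/64, the room left in
    [pr3_le]. *)
Lemma fam_exp_bound f : fam f -> exists2 C : R, 0 <= C &
  forall n i j w, (i < n)%N -> (j < n)%N -> `|f n i j w| <=
    C * \sum_(l < n) pr n i l w * expR ((sqn i w + sqn j w + sqn l w) / 64).
Proof.
move=> [[C C0 [m fC]] _].
have [D D0 HD] := @poly_le_exp R 64^-1 m.+1 ltac:(by rewrite invr_gt0).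
exists (C * D ^+ 3); first by rewrite mulr_ge0// exprn_ge0// ltW.
move=> n i j w iin jn; have n0 : (0 < n)%N by exact: leq_ltn_trans iin.
apply: (le_trans (fC n i j w iin jn)); rewrite -mulrA ler_wpM2l//.
(* The degree is raised by one since Jensen's inequality is available for exponents of the form
   [m.+1]. *)
apply: (le_trans (Bd_exp_le q K j w iin (leqnSn m))); rewrite /Bd exprMn.
have PP0 : 0 <= (Psi i w * Psi j w) ^+ m.+1 by rewrite exprn_ge0// mulr_ge0// Psi_ge0.
apply: (le_trans (ler_wpM2l PP0 (Av_pow_le q K i m w n0))).
rewrite !mulr_sumr; apply: ler_sum => l _.
rewrite mulrCA [leRHS]mulrCA; apply: ler_wpM2l; first exact: pr_ge0.
have hP k : Psi k w ^+ m.+1 <= D * expR (64^-1 * sqn k w) by apply: HD; exact: sqn_ge0.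
have p0 k : 0 <= Psi k w ^+ m.+1 by rewrite exprn_ge0 ?Psi_ge0.
rewrite [leRHS](_ : _ = (D * expR (64^-1 * sqn i w)) * (D * expR (64^-1 * sqn j w)) *
    (D * expR (64^-1 * sqn l w))); last first.
  rewrite (_ : (_ + _) / 64 = 64^-1 * sqn i w + 64^-1 * sqn j w + 64^-1 * sqn l w); last by field.
  by rewrite !expRD; ring.
rewrite exprMn; apply: ler_pM => //; first exact: mulr_ge0.
exact: ler_pM.
Qed.

(** The weight supplied by [fam_exp_bound] completes p_j^2 to a triple product; summing over its
    index gives n terms of order n^-3. *)
Lemma gint_pr2_bound f : fam f -> exists2 C : R, 0 <= C &
  forall n i j, (i < n)%N -> (j < n)%N ->
    `|gint (n * q) (fun w => pr n i j w * pr n i j w * f n i j w)| <= C / n%:R ^+ 2.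
Proof.
move=> ff; have [C C0 fC] := fam_exp_bound ff.
have K0 : 0 <= Kexp ^+ q :> R by rewrite exprn_ge0// (le_trans ler01 Kexp_ge1).
exists (C * (5 * Kexp ^+ q)); first by rewrite !mulr_ge0.
move=> n i j iin jn; have n0 : (0 < n)%N by exact: leq_ltn_trans iin.
have nZ (l : 'I_n) : nice (n * q) (Zf n i j j l) by exact: nice_Zf.
apply: (@le_trans _ _ (gint (n * q) (fun w => C * \sum_(l < n) Zf n i j j l w))).
  apply: le_norm_gint.
  - have := famM (famM (fam_pr q K) (fam_pr q K)) ff.
    exact: (fam_nice iin jn).
  - by apply: niceZ; exact: nice_sum.
  - move=> w; rewrite normrM ger0_norm; last by rewrite mulr_ge0 ?pr_ge0.
    apply: (le_trans (ler_wpM2l _ (fC n i j w iin jn))).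
      by rewrite mulr_ge0 ?pr_ge0.
    rewrite mulrCA ler_wpM2l// mulr_sumr; apply: ler_sum => l _.
    by rewrite mulrA; exact: (pr3_le ell_le).
rewrite gintZ; last exact: nice_sum.
rewrite gint_sum// -mulrA ler_wpM2l//.
apply: (@le_trans _ _ (\sum_(l < n) (5 * Kexp ^+ q / n%:R ^+ 3))).
  by apply: ler_sum => l _; exact: gint_Zf.
rewrite sumr_const card_ord -mulr_natr le_eqVlt; apply/orP; left; apply/eqP.
by field; rewrite pnatr_eq0 -lt0n.
Qed.

(** Only two weights are at hand, so a third is inserted as a sum of weights equal to 1. There are
    then n^2 terms of order n^-3. *)
Lemma gint_pri_bound f : fam f -> exists2 C : R, 0 <= C &
  forall n i, (i < n)%N ->
    `|gint (n * q) (fun w => pr n i i w * f n i i w)| <= C / n%:R.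
Proof.
move=> ff; have [C C0 fC] := fam_exp_bound ff.
have K0 : 0 <= Kexp ^+ q :> R by rewrite exprn_ge0// (le_trans ler01 Kexp_ge1).
exists (C * (5 * Kexp ^+ q)); first by rewrite !mulr_ge0.
move=> n i iin; have n0 : (0 < n)%N by exact: leq_ltn_trans iin.
have nZ (l m : 'I_n) : nice (n * q) (Zf n i i m l) by exact: nice_Zf.
have nZ' (l : 'I_n) : nice (n * q) (fun w => \sum_(m < n) Zf n i i m l w) by exact: nice_sum.
apply: (@le_trans _ _ (gint (n * q) (fun w => C * \sum_(l < n) \sum_(m < n) Zf n i i m l w))).
  apply: le_norm_gint.
  - exact: (fam_nice iin iin (famM (fam_pr q K) ff)).
  - by apply: niceZ; exact: nice_sum.
  - move=> w; rewrite normrM ger0_norm ?pr_ge0//.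
    apply: (le_trans (ler_wpM2l _ (fC n i i w iin iin))); first exact: pr_ge0.
    rewrite mulrCA ler_wpM2l// mulr_sumr; apply: ler_sum => l _.
    rewrite (_ : pr n i i w = \sum_(m < n) pr n i i w * pr n i m w); last first.
      by rewrite -mulr_sumr sum_pr// mulr1.
    rewrite mulr_suml.
    apply: ler_sum => m _; rewrite mulrA; exact: (pr3_le ell_le).
rewrite gintZ; last exact: nice_sum.
rewrite gint_sum// -mulrA ler_wpM2l//.
apply: (@le_trans _ _ (\sum_(l < n) \sum_(m < n) (5 * Kexp ^+ q / n%:R ^+ 3))).
  by apply: ler_sum => l _; rewrite gint_sum//; apply: ler_sum => m _; exact: gint_Zf.
rewrite !sumr_const !card_ord -mulr_natr -[_ *+ n]mulr_natr le_eqVlt; apply/orP; left; apply/eqP.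
by field; rewrite pnatr_eq0 -lt0n.
Qed.

(* Stein's identity in the coordinates of each sample j <> i replaces the
   factor w_{jb} by u_b, at the price of terms carrying p_j^2 or p_i. *)
Theorem stein_sum (Q E Rr : family) b :
  fam Q -> fam E -> fam Rr ->
  (forall n i j, (i < n)%N -> (j < n)%N -> j != i ->
     pderiv (j * q + b) (Q n i j) (fun w => E n i j w + pr n i j w * Rr n i j w)) ->
  (forall n i j, (i < n)%N -> (j < n)%N -> j != i ->
     pcont (j * q + b) (E n i j) /\ pcont (j * q + b) (Rr n i j)) ->
  exists2 C : R, 0 <= C & forall n i, (i < n)%N ->
    `|gint (n * q) (fun w => \sum_(j < n) pr n i j w * (w (j * q + b)%N * Q n i j w)) -
      gint (n * q) (fun w => \sum_(j < n) pr n i j w * (uu i b w * Q n i j w + E n i j w))|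
    <= C / n%:R.
Proof.
move=> fQ fE fR dQ cER.
have fu := fam_uu dq K b; have fp := fam_pr q K.
have fx := fam_coordj K (ordd_lt dq b).
have [C1 C10 H1] := gint_pr2_bound (famB fR (famM fu fQ)).
have [C2 C20 H2] := gint_pri_bound (famB (famM fx fQ) (famD (famM fu fQ) fE)).
exists (C1 + C2); first exact: addr_ge0.
move=> n i iin; have n0 : (0 < n)%N by exact: leq_ltn_trans iin.
have nL j : (j < n)%N -> nice (n * q) (fun w => pr n i j w * (w (j * q + b)%N * Q n i j w)).
  by move=> jn; exact: (fam_nice iin jn (famM fp (famM fx fQ))).
have nM j : (j < n)%N -> nice (n * q) (fun w => pr n i j w * (uu i b w * Q n i j w + E n i j w)).
  by move=> jn; exact: (fam_nice iin jn (famM fp (famD (famM fu fQ) fE))).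
rewrite gint_sum; last by move=> j; exact: nL.
rewrite gint_sum; last by move=> j; exact: nM.
rewrite -sumrB (le_trans (ler_norm_sum _ _ _))//.
apply: (@le_trans _ _ (\sum_(j < n) (C1 / n%:R ^+ 2 + (if val j == i then C2 / n%:R else 0)))).
  apply: ler_sum => j _; rewrite -gintB; [|exact: nL|exact: nM].
  case: ifPn => [/eqP ->|ji].
    rewrite -[leLHS]add0r; apply: lerD; first by rewrite divr_ge0// exprn_ge0.
    apply: le_trans (H2 n i iin); rewrite le_eqVlt; apply/orP; left; apply/eqP.
    by congr `|_|; apply: eq_gint => w; ring.
  rewrite addr0; apply: le_trans (H1 n i j iin (ltn_ord j)).
  rewrite le_eqVlt; apply/orP; left; apply/eqP; congr `|_|.
  have jn := ltn_ord j.
  have dp := pderiv_pr dq K ji jn b j.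
  have [cE cR] := cER n i j iin jn ji.
  have dQj := dQ n i j iin jn ji.
  have cp := pderiv_cont dp; have cQ := pderiv_cont dQj.
  have cu := pderiv_cont (pderiv_uu dq K ji b b).
  have st := @stein R (n * q) (j * q + b) (fun w => pr n i j w * Q n i j w)
    (fun w => uu i b w * pr n i j w * (1 - pr n i j w) * Q n i j w +
       pr n i j w * (E n i j w + pr n i j w * Rr n i j w)) (idx_lt jn (ordd_lt dq b)).
  rewrite gintB; [|exact: nL|exact: nM].
  rewrite (@eq_gint _ _ _ (fun w => w (j * q + b)%N * (pr n i j w * Q n i j w))); last first.
    by move=> w; ring.
  rewrite st.
  - rewrite -gintB; last 2 first.
    + exact: (fam_nice iin jn (famD (famM (famM (famM fu fp) (famB (fam_cst q K 1) fp)) fQ)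
         (famM fp (famD fE (famM fp fR))))).
    + exact: nM.
    by apply: eq_gint => w; ring.
  - apply: pderiv_eq (pderivM dp dQj) _ => w /=.
    by rewrite eqxx.
  - apply: pcontD.
      by apply: pcontM => //; apply: pcontM; [exact: pcontM|apply: pcontB => //; exact: pcont_cst].
    by apply: pcontM => //; apply: pcontD => //; exact: pcontM.
  - exact: (fam_nice iin jn (famM fp fQ)).
  - exact: (fam_nice iin jn (famD (famM (famM (famM fu fp) (famB (fam_cst q K 1) fp)) fQ)
         (famM fp (famD fE (famM fp fR))))).
  - exact: (fam_nice iin jn (famM fx (famM fp fQ))).
rewrite big_split/= sumr_const card_ord (bigD1 (Ordinal iin))//= eqxx big1 ?addr0; last first.
  by move=> j; rewrite -val_eqE/= => /negbTE ->.
rewrite -mulr_natr le_eqVlt; apply/orP; left; apply/eqP.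
by field; rewrite pnatr_eq0 -lt0n.
Qed.

End softmax_errors.

(** * Limits of mixed moments of attention output, query and covariance *)

Section softmax_moments.
Context {R : realType}.
Variables (d q : nat) (dq : (d <= q)%N) (K : 'M[R]_d).
Implicit Types (w : nat -> R) (n i j l m : nat) (b c e : 'I_d).
Local Notation sqn := (@sqn R q).
Local Notation uu := (uu q K).
Local Notation ell := (ell q K).
Local Notation pr := (pr q K).
Local Notation Gv := (Gv q K).
Local Notation Cov := (Cov q K).
Local Notation fam := (fam q K).
Hypothesis ell_le : forall i j w, `|ell i j w| <= (sqn i w + sqn j w) / 32.

Implicit Types (f g : nat -> nat -> (nat -> R) -> R).

(** The rate is uniform in the query index. Integrability is part of the notion so that limits can
    be added and scaled. *)
Definition approx f (v : R) :=
  (forall n i, (i < n)%N -> nice (n * q) (f n i)) /\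
  exists2 C : R, 0 <= C & forall n i, (i < n)%N ->
    `|gint (n * q) (f n i) - v| <= C / n%:R.

Lemma approx_ext f g v : (forall n i w, (i < n)%N -> f n i w = g n i w) ->
  approx f v -> approx g v.
Proof.
move=> fg [nf [C C0 H]]; split => [n i iin|].
  by rewrite (_ : g n i = f n i); [exact: nf|apply/funext => w; rewrite fg].
exists C => // n i iin.
by rewrite -(@eq_gint _ _ (f n i)); [exact: H|move=> w; rewrite fg].
Qed.

Lemma approx_eq f v v' : v = v' -> approx f v -> approx f v'.
Proof. by move=> ->. Qed.

Lemma approxD f g v v' : approx f v -> approx g v' ->
  approx (fun n i w => f n i w + g n i w) (v + v').
Proof.
move=> [nf [C C0 H]] [ng [D D0 H']]; split => [n i iin|].
  by apply: niceD; [exact: nf|exact: ng].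
exists (C + D); first exact: addr_ge0.
move=> n i iin; rewrite gintD; [|exact: nf|exact: ng].
rewrite opprD addrACA (le_trans (ler_normD _ _))// mulrDl.
by apply: lerD; [exact: H|exact: H'].
Qed.

Lemma approxZ (c : R) f v : approx f v -> approx (fun n i w => c * f n i w) (c * v).
Proof.
move=> [nf [C C0 H]]; split => [n i iin|]; first by apply: niceZ; exact: nf.
exists (`|c| * C); first exact: mulr_ge0.
move=> n i iin; rewrite gintZ; last exact: nf.
by rewrite -mulrBr normrM -mulrA ler_wpM2l// H.
Qed.

Lemma approx_cst (c : R) : approx (fun n i w => c) c.
Proof.
split=> [*|]; first exact: nice_cst.
by exists 0 => // n i _; rewrite gint_cst subrr normr0 mul0r.
Qed.

Lemma approx_sum (J : Type) (s : seq J) (h : J -> nat -> nat -> (nat -> R) -> R) (v : J -> R) :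
  (forall x, approx (h x) (v x)) ->
  approx (fun n i w => \sum_(x <- s) h x n i w) (\sum_(x <- s) v x).
Proof.
move=> hv; elim: s => [|x s IH].
  rewrite big_nil; apply: approx_ext (approx_cst 0) => n i w _.
  by rewrite big_nil.
rewrite big_cons; apply: approx_ext (approxD (hv x) IH) => n i w _.
by rewrite big_cons.
Qed.

Lemma approx_near f g v : (forall n i, (i < n)%N -> nice (n * q) (f n i)) ->
  (exists2 C : R, 0 <= C & forall n i, (i < n)%N ->
     `|gint (n * q) (f n i) - gint (n * q) (g n i)| <= C / n%:R) ->
  approx g v -> approx f v.
Proof.
move=> nf [C C0 H] [ng [D D0 H']]; split => //.
exists (C + D); first exact: addr_ge0.
move=> n i iin; rewrite mulrDl; apply: le_trans (lerD (H n i iin) (H' n i iin)).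
by rewrite -[X in `|X|](subrKA (gint (n * q) (g n i))) ler_normD.
Qed.

Section insertion.
Variables (F : nat -> nat -> (nat -> R) -> R) (RF : family (R := R)) (b : 'I_d).
Hypothesis fF : fam (fun n i j w => F n i w).
Hypothesis fRF : fam RF.
Hypothesis dF : forall n i j, (i < n)%N -> (j < n)%N -> j != i ->
  pderiv (j * q + b) (F n i) (fun w => pr n i j w * RF n i j w).
Hypothesis cRF : forall n i j, (i < n)%N -> (j < n)%N -> j != i ->
  pcont (j * q + b) (RF n i j).

(** The case [Q = F], [E = 0] of [stein_sum]: after the replacement the summands differ only by
    their weights, which sum to 1. *)
Lemma approx_insert_Gv v : approx (fun n i w => uu i b w * F n i w) v ->
  approx (fun n i w => Gv n i b w * F n i w) v.
Proof.
apply: approx_near.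
  by move=> n i iin; exact: (fam_nice iin iin (famM (fam_Gv dq K b) fF)).
have [||C C0 H] := stein_sum dq ell_le fF (fam_cst q K 0) fRF (b := b).
- move=> n i j iin jn ji; apply: pderiv_eq (dF iin jn ji) _ => w.
  by rewrite add0r.
- by move=> n i j iin jn ji; split; [exact: pcont_cst|exact: cRF].
exists C => // n i iin; apply: le_trans (H n i iin).
have n0 : (0 < n)%N by exact: leq_ltn_trans iin.
rewrite le_eqVlt; apply/orP; left; apply/eqP; congr (`|_ - _|).
  apply: eq_gint => w; rewrite /Gv mulr_suml; apply: eq_bigr => j _.
  by rewrite mulrA.
apply: eq_gint => w; rewrite -mulr_suml sum_pr// mul1r addr0.
by [].
Qed.

(** Here [Q] is [F] times the centred key. The explicit derivative of the key yields the Kronecker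
    symbol, while the term with factor u vanishes identically because centred keys have weighted
    mean 0. *)
Lemma approx_insert_Cov c v : approx F v ->
  approx (fun n i w => F n i w * Cov n i b c w) ((b == c)%:R * v).
Proof.
move=> aF; have fx := fam_coordj K (ordd_lt dq c).
have fxb := fam_coordj K (ordd_lt dq b).
have fG := fam_Gv dq K c; have fu := fam_uu dq K b.
have fd := fam_cst q K ((b == c)%:R : R).
pose Q : family (R := R) := fun n i j w => F n i w * (w (j * q + c)%N - Gv n i c w).
pose E : family (R := R) := fun n i j w => (b == c)%:R * F n i w.
pose Rr : family (R := R) := fun n i j w => RF n i j w * (w (j * q + c)%N - Gv n i c w) +
  F n i w * (0 - ((b == c)%:R + uu i b w * (w (j * q + c)%N - Gv n i c w))).
have fQ : fam Q by apply: famM => //; exact: famB.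
have fE : fam E by exact: famM.
have fR : fam Rr.
  apply: famD; first by apply: famM => //; exact: famB.
  apply: famM => //; apply: famB; first exact: fam_cst.
  by apply: famD => //; apply: famM => //; exact: famB.
have n1 n i : (i < n)%N -> nice (n * q) (fun w =>
    \sum_(j < n) pr n i j w * (w (j * q + b)%N * Q n i j w)).
  move=> iin; apply: nice_sum => j.
  exact: (fam_nice iin (ltn_ord j) (famM (fam_pr q K) (famM fxb fQ))).
have eqL n i w : F n i w * Cov n i b c w =
    \sum_(j < n) pr n i j w * (w (j * q + b)%N * Q n i j w).
  by rewrite mulr_sumr; apply: eq_bigr => j _; rewrite /Q; ring.
apply: (@approx_ext (fun n i w => \sum_(j < n) pr n i j w * (w (j * q + b)%N * Q n i j w))).
  by move=> n i w _; rewrite eqL.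
apply: approx_near (approxZ (b == c)%:R aF) => //.
have [||C C0 H] := stein_sum dq ell_le fQ fE fR (b := b).
- move=> n i j iin jn ji.
  apply: pderiv_eq.
    apply: pderivM (dF iin jn ji) _.
    exact: pderivB (pderiv_coord _ _) (pderiv_Gv dq K ji jn b c).
  move=> w /=; rewrite /Q /E /Rr idx_eq ?ordd_lt// eqxx/= [(c == b :> nat)]eq_sym val_eqE.
  by ring.
- move=> n i j iin jn ji.
  have cF := pderiv_cont (dF iin jn ji).
  have cG := pderiv_cont (pderiv_Gv dq K ji jn b c).
  have cu := pderiv_cont (pderiv_uu dq K ji b b).
  have cx : pcont (j * q + b) (fun w => w (j * q + c)%N : R).
    exact: pderiv_cont (pderiv_coord _ _).
  have cR := cRF iin jn ji.
  have cB := pcontB cx cG.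
  split; first by apply: pcontM => //; exact: pcont_cst.
  apply: pcontD; first exact: pcontM.
  apply: pcontM => //; apply: pcontB; first exact: pcont_cst.
  by apply: pcontD; [exact: pcont_cst|exact: pcontM].
exists C => // n i iin; apply: le_trans (H n i iin).
have n0 : (0 < n)%N by exact: leq_ltn_trans iin.
rewrite le_eqVlt; apply/orP; left; apply/eqP; congr (`|_ - _|).
apply: eq_gint => w.
rewrite (eq_bigr (fun j : 'I_n => uu i b w * F n i w * (pr n i j w * w (j * q + c)%N) +
   pr n i j w * ((b == c)%:R * F n i w - uu i b w * F n i w * Gv n i c w))); last first.
  by move=> j _; rewrite /Q /E; ring.
rewrite big_split/= -mulr_sumr -mulr_suml sum_pr// -/(Gv n i c w); ring.
Qed.

End insertion.

(** The limit of the moment of [Gv n i b] with coordinate [l] of the query's block: the entry of [K]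
    when [l < d], and 0 on noise coordinates. *)
Definition kap l b : R := \sum_(a < d) K a b * (l == a)%:R.

Lemma approx_coord2 l m : (l < q)%N -> (m < q)%N ->
  approx (fun n i w => w (i * q + l)%N * w (i * q + m)%N) (l == m)%:R.
Proof.
move=> lq mq; split => [n i iin|].
  by apply: nice_coord2; exact: idx_lt.
exists 0 => // n i iin; rewrite gint_coord2; [|exact: idx_lt|exact: idx_lt].
by rewrite eqn_add2l subrr normr0 mul0r.
Qed.

Lemma approx_uu b f (v : nat -> R) :
  (forall a : 'I_d, approx (fun n i w => w (i * q + a)%N * f n i w) (v a)) ->
  approx (fun n i w => uu i b w * f n i w) (\sum_(a < d) K a b * v a).
Proof.
move=> H; have := approx_sum (index_enum 'I_d) (fun a => approxZ (K a b) (H a)).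
by apply: approx_ext => n i w _; rewrite mulr_suml; apply: eq_bigr => a _; rewrite mulrA.
Qed.

Lemma approx_Gv_coord b l : (l < q)%N ->
  approx (fun n i w => Gv n i b w * w (i * q + l)%N) (kap l b).
Proof.
move=> lq; apply: (@approx_insert_Gv _ (fun n i j w => 0)).
- exact: fam_coordi.
- exact: fam_cst.
- move=> n i j iin jn ji; apply: pderiv_eq (pderiv_block dq ji b lq) _ => w.
  by rewrite mulr0.
- by move=> *; exact: pcont_cst.
- apply: (@approx_uu b _ (fun a => (l == a)%:R)) => a.
  by rewrite eq_sym; apply: approx_coord2 => //; exact: ordd_lt.
Qed.

Lemma fam_dGv b c : fam (fun n i j w => (b == c)%:R + uu i b w * (w (j * q + c)%N - Gv n i c w)).
Proof.
apply: famD; first exact: fam_cst.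
apply: famM; first exact: fam_uu.
by apply: famB; [apply: fam_coordj; exact: ordd_lt|exact: fam_Gv].
Qed.

Lemma pcont_dGv n i j b c : (j < n)%N -> j != i ->
  pcont (j * q + b) (fun w => (b == c)%:R + uu i b w * (w (j * q + c)%N - Gv n i c w)).
Proof.
move=> jn ji; apply: pcontD; first exact: pcont_cst.
apply: pcontM; first exact: pderiv_cont (pderiv_uu dq K ji b b).
apply: pcontB; first exact: pderiv_cont (pderiv_coord _ _).
exact: pderiv_cont (pderiv_Gv dq K ji jn b c).
Qed.

(** One output is replaced by u, the other playing the role of [F]; its derivative carries the
    weight p_j and so disappears in the limit. The limit is an entry of K^T K. *)
Lemma approx_Gv_Gv b c :
  approx (fun n i w => Gv n i b w * Gv n i c w) (\sum_(a < d) K a b * kap a c).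
Proof.
apply: (approx_insert_Gv (fam_Gv dq K c) (fam_dGv b c)).
- by move=> n i j iin jn ji; exact: pderiv_Gv.
- by move=> n i j iin jn ji; exact: pcont_dGv.
- apply: (@approx_uu b _ (fun a => kap a c)) => a.
  apply: approx_ext (approx_Gv_coord c (ordd_lt dq a)) => n i w _.
  by rewrite mulrC.
Qed.

Lemma approx_coord2_Cov b c l m : (l < q)%N -> (m < q)%N ->
  approx (fun n i w => w (i * q + l)%N * w (i * q + m)%N * Cov n i b c w)
    ((b == c)%:R * (l == m)%:R).
Proof.
move=> lq mq; apply: (@approx_insert_Cov _ (fun n i j w => 0)).
- by apply: famM; exact: fam_coordi.
- exact: fam_cst.
- move=> n i j iin jn ji.
  apply: pderiv_eq (pderivM (pderiv_block dq ji b lq) (pderiv_block dq ji b mq)) _ => w.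
  by rewrite !mulr0 mul0r addr0.
- by move=> *; exact: pcont_cst.
- exact: approx_coord2.
Qed.

Lemma approx_Gv_coord_Cov b c e l : (l < q)%N ->
  approx (fun n i w => Gv n i e w * w (i * q + l)%N * Cov n i b c w)
    ((b == c)%:R * kap l e).
Proof.
move=> lq; apply: (@approx_insert_Cov _ (fun n i j w =>
  ((b == e)%:R + uu i b w * (w (j * q + e)%N - Gv n i e w)) * w (i * q + l)%N)).
- by apply: famM; [exact: fam_Gv|exact: fam_coordi].
- by apply: famM; [exact: fam_dGv|exact: fam_coordi].
- move=> n i j iin jn ji.
  apply: pderiv_eq (pderivM (pderiv_Gv dq K ji jn b e) (pderiv_block dq ji b lq)) _ => w.
  by rewrite mulr0 addr0 mulrA.
- move=> n i j iin jn ji; apply: pcontM; first exact: pcont_dGv.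
  exact: pderiv_cont (pderiv_block dq ji b lq).
- exact: approx_Gv_coord.
Qed.

End softmax_moments.

(** * The population loss and its gradient *)

Section population.
Context {R : realType}.

(** Stein's identity gives the tilted mean without evaluating the normalizing integral, since
    differentiating [f] in coordinate [c] multiplies it by [r c]. Positivity comes from
    [1 + x <= expR x], whose left side has expectation 1. *)
Lemma gint_expR_linear (d : nat) (r : 'I_d -> R) :
  let f := fun v : nat -> R => expR (\sum_(b < d) r b * v b) in
  [/\ nice d f, forall c : 'I_d, nice d (fun v => v c * f v),
      0 < gint d f &
      forall c : 'I_d, gint d (fun v => v c * f v) = r c * gint d f].
Proof.
move=> f.
have mf : smeas f.
  apply: smeas_expR; apply: smeas_sum => b.
  by apply: smeasM; [exact: smeas_cst|exact: smeas_coord].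
(* From r v <= r^2 + v^2/4 in every coordinate. *)
pose C := expR (\sum_(b < d) r b ^+ 2).
have fle v : `|f v| <= C * expR (4^-1 * wsum xpredT d v).
  rewrite ger0_norm ?expR_ge0// -expRD ler_expR /wsum mulr_sumr -big_split/=.
  apply: ler_sum => b _; rewrite mul1r.
  by have := sqr_ge0 (r b - v b / 2); nra.
have nf : nice d f.
  split=> //; exists C => v; apply: (le_trans (fle v)).
  rewrite ler_wpM2l ?expR_ge0// ler_expR ler_wpM2r ?wsum_ge0// /lam; lra.
have nvf (c : 'I_d) : nice d (fun v => v c * f v).
  split; first by apply: smeasM => //; exact: smeas_coord.
  (* The rate 3/16 is what remains of [lam] after 1/4. *)
  have [D D0 HD] := @poly_le_exp R (3 / 16) 1 ltac:(by rewrite divr_gt0).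
  exists (D * C) => v; rewrite normrM.
  rewrite [leRHS](_ : _ = (D * expR (3 / 16 * wsum xpredT d v)) *
     (C * expR (4^-1 * wsum xpredT d v))); last first.
    by rewrite mulrACA -expRD; congr (_ * expR _); rewrite /lam; field.
  apply: ler_pM => //; apply: le_trans (HD _ (wsum_ge0 _ _ _)).
  rewrite expr1; have H : v c ^+ 2 <= wsum xpredT d v.
    rewrite /wsum (bigD1 c)//= mul1r lerDl.
    by apply: sumr_ge0 => j _; rewrite mul1r sqr_ge0.
  move: H; rewrite -real_normK ?num_real//.
  by have := sqr_ge0 (`|v c| - 1); nra.
split => //.
- pose g := fun v : nat -> R => 1 + \sum_(b < d) r b * v b.
  have nl (b : 'I_d) : nice d (fun v : nat -> R => r b * v b).
    by apply: niceZ; exact: nice_coord.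
  have ng : nice d g by apply: niceD; [exact: nice_cst|exact: nice_sum].
  apply: (@lt_le_trans _ _ (gint d g)); last first.
    by apply: le_gint => // v; exact: expR_ge1Dx.
  rewrite gintD; [|exact: nice_cst|exact: nice_sum].
  rewrite gint_cst gint_sum// big1 ?addr0// => b _.
  by rewrite gintZ ?gint_coord ?mulr0//; exact: nice_coord.
- move=> c; rewrite -gintZ//.
  have dl : pderiv c (fun v : nat -> R => \sum_(b < d) r b * v b) (fun=> r c).
    apply: pderiv_eq; first apply: pderiv_sum => b.
      by apply: pderivM; [exact: pderiv_cst|exact: pderiv_coord].
    move=> w /=; rewrite (bigD1 c)//= mul0r add0r eqxx mulr1 big1 ?addr0// => b bc.
    by rewrite mul0r add0r val_eqE (negbTE bc) mulr0.
  apply: stein => //.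
  + exact: pderiv_exp dl.
  + apply: pcontM; first exact: pcont_cst.
    exact: pderiv_cont (pderiv_exp dl).
  + exact: niceZ.
Qed.

(** Standard coordinates are orthonormal in L^2, so only the squares of the entries survive. *)
Lemma gint_frob2_linear (k p : nat) (N : 'M[R]_(p, k)) :
  gint k (fun w => frob2 (N *m colv k 0 w)) = frob2 N.
Proof.
have nn (i : 'I_p) (l m : 'I_k) : nice k (fun w : nat -> R => (N i l * N i m) * (w l * w m)).
  by apply: niceZ; apply: nice_coord2.
rewrite (@eq_gint _ _ _ (fun w => \sum_(i < p) \sum_(l < k) \sum_(m < k)
   (N i l * N i m) * (w l * w m))); last first.
  move=> w; apply: eq_bigr => i _; rewrite big_ord1 mxE expr2 mulr_suml.
  apply: eq_bigr => l _; rewrite mulr_sumr; apply: eq_bigr => m _.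
  by rewrite !mxE !add0n; ring.
rewrite gint_sum; last by move=> i; do 2 (apply: nice_sum => ?).
apply: eq_bigr => i _; rewrite gint_sum; last by move=> l; apply: nice_sum.
apply: eq_bigr => l _; rewrite gint_sum//.
rewrite (bigD1 l)//= gintZ ?gint_coord2 ?eqxx ?mulr1//; last exact: nice_coord2.
rewrite -expr2 big1 ?addr0// => m ml.
rewrite gintZ ?gint_coord2//; last exact: nice_coord2.
by rewrite val_eqE eq_sym (negbTE ml) mulr0.
Qed.

Lemma frob2_row_mx (p d e : nat) (X : 'M[R]_(p, d)) (Y : 'M[R]_(p, e)) :
  frob2 (row_mx X Y) = frob2 X + frob2 Y.
Proof.
rewrite /frob2 -big_split/=; apply: eq_bigr => i _.
rewrite big_split_ord/=; congr (_ + _); apply: eq_bigr => j _.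
  by rewrite row_mxEl.
by rewrite row_mxEr.
Qed.

Lemma colv_add (d p : nat) (w : nat -> R) (o : nat) :
  colv (d + p) o w = col_mx (colv d o w) (colv p (o + d) w).
Proof.
apply/matrixP => i j; rewrite !mxE; case: splitP => k ->; rewrite mxE//.
by rewrite addnA.
Qed.

Lemma frob2N (m n : nat) (X : 'M[R]_(m, n)) : frob2 (- X) = frob2 X.
Proof.
by apply: eq_bigr => i _; apply: eq_bigr => j _; rewrite mxE sqrrN.
Qed.

Variables (p d : nat) (S12 : 'M[R]_d) (O12 : 'M[R]_p) (M : 'M[R]_(p, d)).
Hypothesis S12T : S12^T = S12.

(* Exponential tilting translates a Gaussian. *)
Lemma population_attention (B : 'M[R]_d) (x : 'cV[R]_d) :
  (gint d (fun v => expR (bil x B (S12 *m colv d 0 v))))^-1 *: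
    (\col_(a < d) gint d (fun v => expR (bil x B (S12 *m colv d 0 v)) *
                                   (S12 *m colv d 0 v) a 0)) =
  S12 *m S12 *m B^T *m x.
Proof.
pose r (b : 'I_d) := (x^T *m B *m S12) 0 b.
have bE v : bil x B (S12 *m colv d 0 v) = \sum_(b < d) r b * v b.
  rewrite /bil mulmxA mxE; apply: eq_bigr => b _.
  by rewrite [colv _ _ _ _ _]mxE add0n.
have [nf nvf f0 fE] := gint_expR_linear r; move: nf nvf f0 fE.
set f := fun v => expR _ => nf nvf f0 fE.
have -> : (fun v => expR (bil x B (S12 *m colv d 0 v))) = f.
  by apply/funext => v; rewrite bE.
apply/colP => a; rewrite [LHS]mxE [X in _ * X]mxE.
rewrite [X in _ * X](@eq_gint _ _ _ (fun v => \sum_(c < d) S12 a c * (v c * f v))); last first.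
  move=> v; rewrite bE -/(f v) mxE mulr_sumr; apply: eq_bigr => c _.
  by rewrite [colv _ _ _ _ _]mxE add0n mulrCA [f v * _]mulrC.
rewrite gint_sum; last by move=> c; apply: niceZ; exact: nvf.
have -> : S12 *m S12 *m B^T *m x = S12 *m (x^T *m B *m S12)^T.
  by rewrite !trmx_mul trmxK S12T !mulmxA.
rewrite mulr_sumr [RHS]mxE; apply: eq_bigr => c _.
rewrite gintZ// fE [in RHS]mxE -/(r c).
by field; rewrite gt_eqF.
Qed.

(** In standard coordinates the population residual is [Cmx A B] applied to g, minus [O12] applied
    to the noise. The loss is therefore quadratic in [Cmx], which is affine in [A] and in [B]
    separately. *)
Definition Cmx (A : 'M[R]_(p, d)) (B : 'M[R]_d) : 'M[R]_(p, d) :=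
  A *m S12 *m S12 *m B^T *m S12 - M *m S12.

Lemma LpopE A B :
  Lpop S12 O12 M A B = 2^-1 * (frob2 (Cmx A B) + frob2 O12).
Proof.
rewrite /Lpop; congr (_ * _).
rewrite -[frob2 O12]frob2N -frob2_row_mx -gint_frob2_linear.
apply: eq_gint => w; rewrite population_attention; congr frob2.
rewrite colv_add mul_row_col /Cmx mulmxBl mulNmx add0n opprD addrA.
by rewrite !mulmxA.
Qed.

Lemma derive1_frob2_line (m n : nat) (C D : 'M[R]_(m, n)) (c : R) :
  derive1 (fun t : R => 2^-1 * (frob2 (C + t *: D) + c)) 0 =
  \sum_(i < m) \sum_(j < n) C i j * D i j.
Proof.
apply: is_derive_derive1.
pose h t : R := \sum_(i < m) \sum_(j < n) (C i j + t * D i j) * (C i j + t * D i j).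
rewrite (_ : (fun t => _) = (fun t => 2^-1 * (h t + c))); last first.
  apply/funext => t; congr (_ * (_ + _)); apply: eq_bigr => i _; apply: eq_bigr => j _.
  by rewrite !mxE expr2.
have dij i j := is_derive_fD (is_derive_fcst (C i j) 0)
  (is_derive_fM (is_derive_fid 0) (is_derive_fcst (D i j) 0)).
have dh := is_derive_fsum (index_enum 'I_m) (fun i =>
  is_derive_fsum (index_enum 'I_n) (fun j => is_derive_fM (dij i j) (dij i j))).
have dd := is_derive_fM (is_derive_fcst 2^-1 0) (is_derive_fD dh (is_derive_fcst c 0)).
apply: (is_derive_subst dd).
rewrite mul0r add0r addr0 mulr_sumr; apply: eq_bigr => i _.
rewrite mulr_sumr; apply: eq_bigr => j _.
by field.
Qed.

Lemma delta_mulE (k l m : nat) (a : 'I_k) (b : 'I_l) (Y : 'M[R]_(l, m)) r c :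
  (delta_mx a b *m Y) r c = (r == a)%:R * Y b c.
Proof.
rewrite mxE (bigD1 b)//= mxE eqxx andbT big1 ?addr0// => i /negbTE ib.
by rewrite mxE ib andbF mul0r.
Qed.

Lemma gradA_LpopE A B a b : gradA (Lpop S12 O12 M) A B a b =
  \sum_(c < d) Cmx A B a c * (S12 *m S12 *m B^T *m S12) b c.
Proof.
rewrite mxE (_ : (fun t : R => _) = (fun t : R => 2^-1 *
   (frob2 (Cmx A B + t *: (delta_mx a b *m (S12 *m S12 *m B^T *m S12))) + frob2 O12))); last first.
  apply/funext => t; rewrite LpopE; congr (_ * (frob2 _ + _)).
  by rewrite /Cmx !mulmxDl -!scalemxAl !mulmxA addrAC.
rewrite derive1_frob2_line (bigD1 a)//= [X in _ + X]big1 ?addr0.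
  by apply: eq_bigr => c _; rewrite delta_mulE eqxx mul1r.
by move=> r /negbTE ra; apply: big1 => c _; rewrite delta_mulE ra mul0r mulr0.
Qed.

Lemma gradB_LpopE A B a b : gradB (Lpop S12 O12 M) A B a b =
  \sum_(r < p) \sum_(c < d) Cmx A B r c * ((A *m S12 *m S12) r b * S12 a c).
Proof.
rewrite mxE (_ : (fun t : R => _) = (fun t : R => 2^-1 *
   (frob2 (Cmx A B + t *: (A *m S12 *m S12 *m (delta_mx b a *m S12))) + frob2 O12))); last first.
  apply/funext => t; rewrite LpopE; congr (_ * (frob2 _ + _)).
  rewrite /Cmx linearD linearZ/= trmx_delta mulmxDr mulmxDl -!scalemxAr -!scalemxAl.
  by rewrite !mulmxA addrAC.
rewrite derive1_frob2_line; apply: eq_bigr => r _; apply: eq_bigr => c _.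
congr (_ * _); rewrite mxE (bigD1 b)//= delta_mulE eqxx mul1r big1 ?addr0//.
by move=> k /negbTE kb; rewrite delta_mulE kb mul0r mulr0.
Qed.

End population.

(** * The empirical gradient in standard coordinates *)

Section empirical.
Context {R : realType}.
Variables (p d : nat) (S12 : 'M[R]_d) (O12 : 'M[R]_p) (M : 'M[R]_(p, d)).
Variables (A : 'M[R]_(p, d)) (B : 'M[R]_d).
Hypothesis S12T : S12^T = S12.
Implicit Types (w : nat -> R) (n i j : nat).
Local Notation q := (d + p)%N.
Local Notation K := (S12 *m B *m S12).
Local Notation x i w := (sample_x p S12 i w).
Local Notation z i w := (sample_z d O12 i w).
Local Notation pr := (pr q K).
Local Notation Gv := (Gv q K).
Local Notation Cov := (Cov q K).

Lemma sample_xE i w a : x i w a 0 = \sum_(l < d) S12 a l * w (i * q + l)%N.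
Proof. by rewrite mxE; apply: eq_bigr => l _; rewrite mxE. Qed.

Lemma sample_bil i j w : bil (x i w) B (x j w) = ell q K i j w.
Proof.
have -> : bil (x i w) B (x j w) =
    ((colv d (i * q) w)^T *m K *m colv d (j * q) w) 0 0.
  by rewrite /bil /sample_x trmx_mul S12T !mulmxA.
rewrite mxE; apply: eq_bigr => b _; rewrite [colv _ _ _ b _]mxE; congr (_ * _).
by rewrite mxE; apply: eq_bigr => a _; rewrite !mxE mulrC.
Qed.

Lemma sum_expR_bil n i w : \sum_(j < n) expR (bil (x i w) B (x j w)) = Dn q K n i w.
Proof. by apply: eq_bigr => j _; rewrite sample_bil. Qed.

Definition att n i w (B' : 'M[R]_d) : 'cV[R]_d :=
  (\sum_(j < n) expR (bil (x i w) B' (x j w)))^-1 *: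
  \sum_(j < n) (expR (bil (x i w) B' (x j w)) *: x j w).

Lemma att_entry n i w B' e : att n i w B' e 0 =
  (\sum_(j < n) expR (bil (x i w) B' (x j w)))^-1 *
  \sum_(j < n) (expR (bil (x i w) B' (x j w)) * x j w e 0).
Proof.
by rewrite mxE summxE; congr (_ * _); apply: eq_bigr => j _; rewrite mxE.
Qed.

Lemma att_prE n i w e : att n i w B e 0 = \sum_(j < n) pr n i j w * x j w e 0.
Proof.
rewrite att_entry sum_expR_bil mulr_sumr; apply: eq_bigr => j _.
by rewrite sample_bil /pr mulrA [_^-1 * _]mulrC.
Qed.

Lemma attE n i w e : att n i w B e 0 = \sum_(b < d) S12 e b * Gv n i b w.
Proof.
rewrite att_prE; under eq_bigr do rewrite sample_xE mulr_sumr.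
rewrite exchange_big/=; apply: eq_bigr => b _; rewrite mulr_sumr.
by apply: eq_bigr => j _; rewrite mulrCA.
Qed.

(** The response M x_i + z_i as a linear image of the full block of [d + p] standard coordinates. *)
Definition Nmx : 'M[R]_(p, q) := row_mx (M *m S12) O12.

Definition resid n i r w : R :=
  \sum_(c < d) (A *m S12) r c * Gv n i c w - \sum_(m < q) Nmx r m * w (i * q + m)%N.

Lemma residE n i w r :
  (A *m att n i w B - (M *m x i w + z i w)) r 0 = resid n i r w.
Proof.
have -> : att n i w B = S12 *m (\col_b Gv n i b w).
  by apply/colP => e; rewrite attE mxE; apply: eq_bigr => b _; rewrite mxE.
have -> : M *m x i w + z i w = Nmx *m colv q (i * q) w.
  by rewrite colv_add mul_row_col /sample_x /sample_z !mulmxA.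
rewrite mulmxA mxE [X in _ + X]mxE /resid; congr (_ - _); rewrite mxE; apply: eq_bigr => m _.
  by rewrite [X in _ * X]mxE.
by rewrite [X in _ * X]mxE.
Qed.

Lemma LhatE n w A' B' : Lhat n S12 O12 M A' B' w =
  (2 * n%:R)^-1 * \sum_(i < n) \sum_(r < p)
     (A' *m att n i w B' - (M *m x i w + z i w)) r 0 ^+ 2.
Proof.
rewrite /Lhat; congr (_ * _); apply: eq_bigr => i _; rewrite /frob2.
by apply: eq_bigr => r _; rewrite big_ord1.
Qed.

(** Formulated for curves through ([A], [B]), so that both partial gradients are instances. *)
Lemma derive1_Lhat n w (A' : R -> 'M[R]_(p, d)) (B' : R -> 'M[R]_d) (dX : 'I_n -> 'I_p -> R) :
  A' 0 = A -> B' 0 = B ->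
  (forall (i : 'I_n) (r : 'I_p), is_derive (0 : R) 1
    (fun t => (A' t *m att n i w (B' t) - (M *m x i w + z i w)) r 0) (dX i r)) ->
  derive1 (fun t => Lhat n S12 O12 M (A' t) (B' t) w) 0 =
  n%:R^-1 * \sum_(i < n) \sum_(r < p) resid n i r w * dX i r.
Proof.
move=> A0 B0 dXP; apply: is_derive_derive1.
have dh := is_derive_fsum (index_enum 'I_n) (fun i : 'I_n =>
  is_derive_fsum (index_enum 'I_p) (fun r => is_derive_fM (dXP i r) (dXP i r))).
have dd := is_derive_fM (is_derive_fcst (2 * n%:R)^-1 0) dh.
rewrite (_ : (fun t => Lhat _ _ _ _ _ _ _) = (fun t => (2 * n%:R)^-1 *
    \sum_(i < n) \sum_(r < p)
     ((A' t *m att n i w (B' t) - (M *m x i w + z i w)) r 0 *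
      (A' t *m att n i w (B' t) - (M *m x i w + z i w)) r 0))); last first.
  by apply/funext => t; rewrite LhatE.
apply: (is_derive_subst dd).
rewrite mul0r add0r invfM -mulrA mulrCA; congr (_ * _).
rewrite mulr_sumr; apply: eq_bigr => i _; rewrite mulr_sumr; apply: eq_bigr => r _.
by rewrite A0 B0 residE; field.
Qed.

Lemma gradA_LhatE n w a b :
  gradA (fun A' B' => Lhat n S12 O12 M A' B' w) A B a b =
  n%:R^-1 * \sum_(i < n) resid n i a w * \sum_(f < d) S12 b f * Gv n i f w.
Proof.
have dX (i : 'I_n) (r : 'I_p) : is_derive (0 : R) 1
    (fun t => ((A + t *: delta_mx a b) *m att n i w B - (M *m x i w + z i w)) r 0)
    ((r == a)%:R * att n i w B b 0).
  have d1 := is_derive_fM (is_derive_fid 0) (is_derive_fcst ((r == a)%:R * att n i w B b 0) 0).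
  have d2 := is_derive_fD (is_derive_fcst (resid n i r w) 0) d1.
  rewrite (_ : (fun t => _) = (fun t => resid n i r w + t * ((r == a)%:R * att n i w B b 0))).
    by apply: (is_derive_subst d2); rewrite mul1r mul0r addr0 add0r.
  apply/funext => t; rewrite -residE mulmxDl -scalemxAl addrAC mxE; congr (_ + _).
  by rewrite mxE delta_mulE.
have A0 : A + 0 *: delta_mx a b = A by rewrite scale0r addr0.
rewrite mxE (derive1_Lhat (A' := fun t => A + t *: delta_mx a b) (B' := fun=> B) A0 erefl dX).
congr (_ * _); apply: eq_bigr => i _.
rewrite (bigD1 a)//= eqxx mul1r big1 ?addr0 ?attE// => r /negbTE ->.
by rewrite mul0r mulr0.
Qed.

Lemma bil_delta (u v : 'cV[R]_d) a b (t : R) :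
  bil u (B + t *: delta_mx a b) v = bil u B v + t * (u a 0 * v b 0).
Proof.
rewrite /bil mulmxDr mulmxDl mxE; congr (_ + _).
rewrite -scalemxAr -scalemxAl mxE; congr (_ * _).
rewrite -mulmxA mxE (bigD1 a)//= delta_mulE eqxx mul1r mxE big1 ?addr0//.
by move=> k /negbTE ka; rewrite delta_mulE ka mul0r mulr0.
Qed.

Lemma sum_pr_cov n i w a b : (0 < n)%N ->
  \sum_(j < n) pr n i j w * (x j w a 0 * (x j w b 0 - att n i w B b 0)) =
  \sum_(h < d) \sum_(f < d) S12 a h * S12 b f * Cov n i h f w.
Proof.
move=> n0.
have xb j : x j w b 0 - att n i w B b 0 = \sum_(f < d) S12 b f * (w (j * q + f)%N - Gv n i f w).
  rewrite sample_xE attE -sumrB; apply: eq_bigr => f _; ring.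
under eq_bigr => j _.
  rewrite xb sample_xE mulr_suml mulr_sumr.
  under eq_bigr => h _ do rewrite !mulr_sumr.
  over.
rewrite exchange_big/=; apply: eq_bigr => h _.
rewrite exchange_big/=; apply: eq_bigr => f _.
by rewrite mulr_sumr; apply: eq_bigr => j _; ring.
Qed.

(** Along this direction logit j moves at speed x_ia x_jb. The quotient rule thus produces x_ia
    times the softmax covariance of the entries [e] and [b] of the keys, rewritten in standard
    coordinates by [sum_pr_cov]. *)
Lemma is_derive_att n i w a b e : (0 < n)%N ->
  is_derive (0 : R) 1 (fun t => att n i w (B + t *: delta_mx a b) e 0)
    (x i w a 0 * \sum_(h < d) \sum_(f < d) S12 e h * S12 b f * Cov n i h f w).
Proof.
move=> n0.
pose kp j := x i w a 0 * x j w b 0.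
pose lg j t := ell q K i j w + t * kp j.
have dl (j : 'I_n) := is_derive_fexp (is_derive_fD (is_derive_fcst (ell q K i j w) 0)
  (is_derive_fM (is_derive_fid 0) (is_derive_fcst (kp j) 0))).
have dD := is_derive_fsum (index_enum 'I_n) dl.
have dN := is_derive_fsum (index_enum 'I_n) (fun j : 'I_n =>
  is_derive_fM (dl j) (is_derive_fcst (x j w e 0) 0)).
have D0 : \sum_(j < n) expR (ell q K i j w + 0 * kp j) != 0.
  by under eq_bigr do rewrite mul0r addr0; rewrite gt_eqF//; exact: (Dn_gt0 q K i w n0).
have dd := is_derive_fM (is_derive_fV D0 dD) dN.
rewrite (_ : (fun t => att _ _ _ _ _ _) = (fun t => (\sum_(j < n) expR (lg j t))^-1 *
   \sum_(j < n) (expR (lg j t) * x j w e 0))); last first.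
  apply/funext => t; rewrite att_entry.
  by congr (_^-1 * _); apply: eq_bigr => j _; rewrite bil_delta sample_bil.
apply: (is_derive_subst dd).
rewrite -sum_pr_cov//.
have -> : \sum_(j < n) expR (ell q K i j w + 0 * kp j) = Dn q K n i w.
  by apply: eq_bigr => j _; rewrite mul0r addr0.
have DD0 : Dn q K n i w != 0 by rewrite gt_eqF// Dn_gt0.
have -> : \sum_(j < n) (0 + (1 * kp j + 0 * 0)) * expR (ell q K i j w + 0 * kp j) =
    Dn q K n i w * (x i w a 0 * att n i w B b 0).
  rewrite att_prE mulrCA mulr_sumr mulr_sumr; apply: eq_bigr => j _.
  by rewrite /kp /pr /wt !mul0r !addr0; field.
have -> : \sum_(j < n) expR (ell q K i j w + 0 * kp j) * x j w e 0 =
    Dn q K n i w * \sum_(j < n) pr n i j w * x j w e 0.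
  rewrite mulr_sumr; apply: eq_bigr => j _.
  by rewrite /pr /wt mul0r addr0; field.
rewrite [X in _ + _ * X = _](_ : _ = Dn q K n i w *
    (x i w a 0 * \sum_(j < n) pr n i j w * (x j w e 0 * x j w b 0))); last first.
  rewrite mulrCA !mulr_sumr; apply: eq_bigr => j _.
  by rewrite /kp /pr /wt !mul0r !addr0; field.
have -> : \sum_(j < n) pr n i j w * (x j w e 0 * (x j w b 0 - att n i w B b 0)) =
  \sum_(j < n) pr n i j w * (x j w e 0 * x j w b 0) -
  att n i w B b 0 * \sum_(j < n) pr n i j w * x j w e 0.
  by rewrite mulr_sumr -sumrB; apply: eq_bigr => j _; ring.
by field.
Qed.

Lemma gradB_LhatE n w a b :
  gradB (fun A' B' => Lhat n S12 O12 M A' B' w) A B a b =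
  n%:R^-1 * \sum_(i < n) \sum_(r < p) resid n i r w *
    (x i w a 0 * \sum_(h < d) \sum_(f < d) (A *m S12) r h * S12 b f * Cov n i h f w).
Proof.
have dX (i : 'I_n) (r : 'I_p) : is_derive (0 : R) 1
    (fun t => (A *m att n i w (B + t *: delta_mx a b) - (M *m x i w + z i w)) r 0)
    (x i w a 0 * \sum_(h < d) \sum_(f < d) (A *m S12) r h * S12 b f * Cov n i h f w).
  have n0 : (0 < n)%N by exact: leq_ltn_trans (ltn_ord i).
  have dd := is_derive_fB (is_derive_fsum (index_enum 'I_d) (fun e =>
     is_derive_fM (is_derive_fcst (A r e) 0) (is_derive_att i w a b e n0)))
     (is_derive_fcst ((M *m x i w + z i w) r 0) 0).
  rewrite (_ : (fun t => _) = (fun t => \sum_(e < d) A r e * att n i w (B + t *: delta_mx a b) e 0 -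
     (M *m x i w + z i w) r 0)); last first.
    by apply/funext => t; rewrite mxE [X in _ + X]mxE mxE.
  apply: (is_derive_subst dd); rewrite subr0.
  under eq_bigr do rewrite mul0r add0r mulrCA.
  rewrite -mulr_sumr; congr (_ * _).
  under eq_bigr do rewrite mulr_sumr.
  rewrite exchange_big/=; apply: eq_bigr => h _.
  under eq_bigr do rewrite mulr_sumr.
  rewrite exchange_big/=; apply: eq_bigr => f _.
  by rewrite mxE !mulr_suml; apply: eq_bigr => e _; ring.
have B0 : B + 0 *: delta_mx a b = B by rewrite scale0r addr0.
by rewrite mxE (derive1_Lhat (A' := fun=> A) (B' := fun t => B + t *: delta_mx a b) erefl B0 dX).
Qed.

End empirical.

(** * Frobenius and operator norms *)

Section operator_norm.
Context {R : realType}.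

Lemma frob2_ge0 (m n : nat) (X : 'M[R]_(m, n)) : 0 <= frob2 X.
Proof. by do 2 (apply: sumr_ge0 => ? _); exact: sqr_ge0. Qed.

Lemma frob2_eq0 (m n : nat) (X : 'M[R]_(m, n)) : frob2 X = 0 -> X = 0.
Proof.
move=> /eqP; rewrite psumr_eq0; last by move=> i _; apply: sumr_ge0 => j _; exact: sqr_ge0.
move=> /allP H; apply/matrixP => i j; rewrite mxE.
have := H i (mem_index_enum i); rewrite psumr_eq0; last by move=> *; exact: sqr_ge0.
by move=> /allP /(_ j (mem_index_enum j)); rewrite /= sqrf_eq0 => /eqP.
Qed.

Lemma frob2_cV (n : nat) (v : 'cV[R]_n) : frob2 v = \sum_(i < n) v i 0 ^+ 2.
Proof. by apply: eq_bigr => i _; rewrite big_ord1. Qed.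

Lemma frob2_tr (m n : nat) (X : 'M[R]_(m, n)) : frob2 X = \tr (X^T *m X).
Proof.
rewrite /frob2 exchange_big; apply: eq_bigr => j _; rewrite mxE.
by apply: eq_bigr => i _; rewrite mxE expr2.
Qed.

Lemma frob2_dot (n : nat) (v : 'cV[R]_n) : frob2 v = (v^T *m v) 0 0.
Proof. by rewrite frob2_tr trace_mx11. Qed.

Lemma frob2_isometry (m n : nat) (U : 'M[R]_(m, n)) (v : 'cV[R]_n) :
  U^T *m U = 1%:M -> frob2 (U *m v) = frob2 v.
Proof.
by move=> UU; rewrite !frob2_dot trmx_mul -mulmxA [U^T *m _]mulmxA UU mul1mx.
Qed.

Lemma frob2Z (m n : nat) (c : R) (X : 'M[R]_(m, n)) : frob2 (c *: X) = c ^+ 2 * frob2 X.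
Proof.
rewrite /frob2 mulr_sumr; apply: eq_bigr => i _; rewrite mulr_sumr.
by apply: eq_bigr => j _; rewrite mxE exprMn.
Qed.

(** The arithmetic-geometric inequality balanced by the weight [s]. A sum of squares is wanted,
    rather than a product of norms, because logits are bounded additively in the two samples. *)
Lemma dot_le (n : nat) (s : R) (g a h : 'cV[R]_n) : 0 <= s ->
  frob2 a <= s ^+ 2 * frob2 h ->
  `|(g^T *m a) 0 0| <= s * (frob2 g + frob2 h) / 2.
Proof.
move=> s0 ah; have [s0'|sn0] := eqVneq s 0.
  have -> : a = 0.
    by apply: frob2_eq0; apply/le_anti; rewrite frob2_ge0 andbT (le_trans ah)// s0' expr0n mul0r.
  by rewrite mulmx0 mxE normr0 s0' !mul0r.
have sp : 0 < s by rewrite lt0r sn0.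
apply: (@le_trans _ _ ((s * frob2 g + s^-1 * frob2 a) / 2)); last first.
  rewrite ler_pM2r ?invr_gt0// mulrDr lerD2l ler_pdivrMl//.
  by apply: (le_trans ah); rewrite expr2 mulrA.
rewrite mxE (le_trans (ler_norm_sum _ _ _))// !frob2_cV !mulr_sumr -big_split/= mulr_suml.
apply: ler_sum => i _; rewrite mxE normrM -(real_normK (num_real (g i 0))) -(real_normK (num_real (a i 0))).
set x := `|g i 0|; set y := `|a i 0|.
rewrite -subr_ge0 (_ : _ - _ = (s * x - y) ^+ 2 / (2 * s)).
  by rewrite divr_ge0 ?sqr_ge0// mulr_ge0.
by field.
Qed.

(** Lagrange's identity: the difference of the two sides is half the sum of the squares (x_i y_j -
    x_j y_i)^2. *)
Lemma cauchy_schwarz_sum (n : nat) (x y : 'I_n -> R) :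
  (\sum_i x i * y i) ^+ 2 <= (\sum_i x i ^+ 2) * (\sum_i y i ^+ 2).
Proof.
have H : 0 <= \sum_i \sum_j (x i * y j - x j * y i) ^+ 2.
  by do 2 (apply: sumr_ge0 => ? _); exact: sqr_ge0.
have E : \sum_i \sum_j (x i * y j - x j * y i) ^+ 2 =
    2 * ((\sum_i x i ^+ 2) * (\sum_i y i ^+ 2) - (\sum_i x i * y i) ^+ 2).
  pose T1 := \sum_i \sum_j x i ^+ 2 * y j ^+ 2.
  pose T2 := \sum_i \sum_j (x i * y i) * (x j * y j).
  have -> : (\sum_i x i ^+ 2) * (\sum_i y i ^+ 2) = T1.
    by rewrite mulr_suml; apply: eq_bigr => i _; rewrite mulr_sumr.
  have -> : (\sum_i x i * y i) ^+ 2 = T2.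
    by rewrite expr2 mulr_suml; apply: eq_bigr => i _; rewrite mulr_sumr.
  have E1 : \sum_i \sum_j x j ^+ 2 * y i ^+ 2 = T1 by rewrite exchange_big.
  transitivity (T1 + \sum_i \sum_j x j ^+ 2 * y i ^+ 2 - 2 * T2); last by rewrite E1; ring.
  rewrite /T1 /T2 mulr_sumr -big_split -sumrB/=; apply: eq_bigr => i _.
  rewrite mulr_sumr -big_split -sumrB/=; apply: eq_bigr => j _; ring.
by move: H; rewrite E pmulr_rge0// subr_ge0.
Qed.

Lemma frob2_mul_le (m n : nat) (X : 'M[R]_(m, n)) (v : 'cV[R]_n) :
  frob2 (X *m v) <= frob2 X * frob2 v.
Proof.
rewrite !frob2_cV /frob2 mulr_suml; apply: ler_sum => i _.
by rewrite mxE; exact: cauchy_schwarz_sum.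
Qed.

(** The Frobenius norm bounds the defining set, so its [sup] is a genuine supremum. *)
Lemma opnorm_ge (m n : nat) (X : 'M[R]_(m, n)) (v : 'cV[R]_n) : frob2 v <= 1 ->
  Num.sqrt (frob2 (X *m v)) <= opnorm X.
Proof.
move=> v1; apply: ub_le_sup; last by exists v.
exists (Num.sqrt (frob2 X)) => _ [u [u1 ->]].
by rewrite ler_wsqrtr// (le_trans (frob2_mul_le _ _))// ler_piMr// frob2_ge0.
Qed.

Lemma opnorm_ge0 (m n : nat) (X : 'M[R]_(m, n)) : 0 <= opnorm X.
Proof.
apply: (le_trans (sqrtr_ge0 _)); apply: (@opnorm_ge _ _ X 0).
by rewrite -[0](scale0r 0) frob2Z expr0n mul0r.
Qed.

Lemma frob2_le_opnorm (m n : nat) (X : 'M[R]_(m, n)) (v : 'cV[R]_n) :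
  frob2 (X *m v) <= opnorm X ^+ 2 * frob2 v.
Proof.
have [/frob2_eq0 ->|v0] := eqVneq (frob2 v) 0.
  by rewrite mulmx0 -[in leLHS](scale0r (0 : 'cV_m)) frob2Z expr0n mul0r
    mulr_ge0 ?sqr_ge0 ?frob2_ge0.
have vp : 0 < frob2 v by rewrite lt0r v0 frob2_ge0.
pose c := (Num.sqrt (frob2 v))^-1.
have c2 : c ^+ 2 = (frob2 v)^-1 by rewrite exprVn sqr_sqrtr ?frob2_ge0.
have H : Num.sqrt (frob2 (X *m (c *: v))) <= opnorm X.
  by apply: opnorm_ge; rewrite frob2Z c2 mulVf.
rewrite -ler_pdivrMr// mulrC -c2 -frob2Z scalemxAr -(sqr_sqrtr (frob2_ge0 _)).
by rewrite ler_sqr ?nnegrE ?sqrtr_ge0 ?opnorm_ge0.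
Qed.

End operator_norm.

(** * Logits near the set S *)

Section logit_bound.
Context {R : realType}.
Variables (p d : nat) (Sigma S12 : 'M[R]_d) (M U : 'M[R]_(p, d)).
Variables (G V : 'M[R]_d) (A : 'M[R]_(p, d)) (B : 'M[R]_d).
Hypothesis uSigma : Sigma \in unitmx.
Hypothesis S12T : S12^T = S12.
Hypothesis S12S : S12 *m S12 = Sigma.
Hypothesis UU : U^T *m U = 1%:M.
Hypothesis VV : V^T *m V = 1%:M.
Hypothesis Gdiag : forall i j, i != j -> G i j = 0.
Hypothesis G0 : forall i, 0 <= G i i.
Hypothesis svd : M *m S12 = U *m G *m V^T.
Local Notation sigma := (opnorm (M *m S12)).

(** Tested on the right singular vector V e_i, whose image has norm [G i i]. *)
Lemma singular_le i : G i i <= sigma.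
Proof.
have Ve1 : frob2 (V *m (delta_mx i 0 : 'cV[R]_d)) <= 1.
  rewrite frob2_isometry// frob2_cV (bigD1 i)//= mxE eqxx expr1n big1 ?addr0//.
  by move=> j /negbTE ji; rewrite mxE ji expr0n.
apply: le_trans (opnorm_ge _ Ve1).
rewrite svd -!mulmxA [V^T *m _]mulmxA VV mul1mx frob2_isometry//.
have -> : G *m (delta_mx i 0 : 'cV[R]_d) = G i i *: (delta_mx i 0 : 'cV_d).
  apply/colP => k; rewrite !mxE (bigD1 i)//= mxE eqxx mulr1 big1 ?addr0.
    have [->|ki] := eqVneq k i; first by rewrite mulr1.
    by rewrite Gdiag// mulr0.
  by move=> j /negbTE ji; rewrite mxE ji mulr0.
rewrite frob2Z frob2_cV (bigD1 i)//= mxE eqxx expr1n big1 ?addr0 ?mulr1.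
  by rewrite sqrtr_sqr ger0_norm.
by move=> j /negbTE ji; rewrite mxE ji expr0n.
Qed.

Lemma frob2_diag_sqrt (y : 'cV[R]_d) : frob2 (diag_sqrt G *m y) <= sigma * frob2 y.
Proof.
rewrite !frob2_cV mulr_sumr; apply: ler_sum => i _.
rewrite mxE (bigD1 i)//= mxE big1 ?addr0 => [|j ji]; last first.
  by rewrite mxE Gdiag 1?eq_sym// sqrtr0 mul0r.
by rewrite exprMn sqr_sqrtr// ler_wpM2r ?sqr_ge0// singular_le.
Qed.

(** The matrix splits into the part from S, of norm at most [sg], and a perturbation of norm at most
    [eps * sO], which is (1/16 - [sg])/2. Together they stay within 1/16, and [dot_le] supplies a
    further factor 1/2. *)
Lemma dot_logit_le (g h : 'cV[R]_d) :
  close_to_S ((2 * Num.sqrt (opnorm Sigma))^-1 * (16^-1 - Num.sqrt sigma))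
    Sigma S12 U G V A B ->
  `|(g^T *m (S12 *m B *m S12) *m h) 0 0| <= (frob2 g + frob2 h) / 32.
Proof.
move=> [J [JJ]]; set sO := Num.sqrt (opnorm Sigma); set sg := Num.sqrt sigma.
set eps := (2 * sO)^-1 * (16^-1 - sg) => HP.
have uS : S12 \in unitmx by move: uSigma; rewrite -S12S unitmx_mul => /andP[].
(* Closeness bounds a norm by the radius, which is therefore nonnegative; below this yields that
   [sg] is at most 1/16. *)
have eps0 : 0 <= eps by exact: le_trans (sqrtr_ge0 _) HP.
have sO0 : 0 <= sO by exact: sqrtr_ge0.
have sO2 : sO ^+ 2 = opnorm Sigma by rewrite sqr_sqrtr ?opnorm_ge0.
have gh0 : 0 <= frob2 g + frob2 h by rewrite addr_ge0 ?frob2_ge0.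
(* In this case the radius contains the default value [0^-1 = 0]. An invertible matrix of norm 0
   leaves only the zero vector, so [h = 0]. *)
have [sOz|sOn] := eqVneq sO 0.
  have -> : h = 0.
    rewrite -[h]mul1mx -(mulVmx uSigma) -mulmxA (_ : Sigma *m h = 0) ?mulmx0//.
    apply: frob2_eq0; apply/le_anti; rewrite frob2_ge0 andbT.
    by rewrite (le_trans (frob2_le_opnorm _ _))// -sO2 sOz !expr0n mul0r.
  by rewrite mulmx0 mxE normr0 divr_ge0// addr_ge0 ?frob2_ge0.
have sOp : 0 < sO by rewrite lt0r sOn.
have sg0 : 0 <= sg by exact: sqrtr_ge0.
have sgle : 0 <= 16^-1 - sg.
  by move: eps0; rewrite /eps pmulr_rge0// invr_gt0 mulr_gt0.
pose D := B - SB S12 V G J.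
have -> : S12 *m B *m S12 = V *m diag_sqrt G *m J^T + S12 *m D *m S12.
  rewrite /D mulmxBr mulmxBl /SB !mulmxA mulmxV// mul1mx.
  by rewrite -[_ *m invmx S12 *m S12]mulmxA mulVmx// mulmx1 addrC subrK.
rewrite mulmxDr mulmxDl mxE (le_trans (ler_normD _ _))//.
have JJ' : (J^T)^T *m J^T = 1%:M by rewrite trmxK; exact: mulmx1C.
have Ha : `|(g^T *m (V *m diag_sqrt G *m J^T) *m h) 0 0| <= sg * (frob2 g + frob2 h) / 2.
  rewrite -mulmxA; apply: dot_le => //.
  rewrite -!mulmxA frob2_isometry// (le_trans (frob2_diag_sqrt _))//.
  by rewrite frob2_isometry// sqr_sqrtr ?opnorm_ge0.
(* One factor [S12] belongs to the P-norm, as the Frobenius norm of [S12 *m D] is the square root of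
   the trace term; the other costs [sO]. *)
have Hb : `|(g^T *m (S12 *m D *m S12) *m h) 0 0| <= (eps * sO) * (frob2 g + frob2 h) / 2.
  rewrite -mulmxA; apply: dot_le; first exact: mulr_ge0.
  rewrite -mulmxA (le_trans (frob2_mul_le _ _))// exprMn -mulrA.
  apply: ler_pM; rewrite ?frob2_ge0//.
    rewrite frob2_tr trmx_mul S12T -mulmxA [S12 *m (S12 *m _)]mulmxA S12S mulmxA.
    have t0 : 0 <= \tr (D^T *m Sigma *m D).
      by rewrite -S12S mulmxA -mulmxA -{1}S12T -trmx_mul -frob2_tr frob2_ge0.
    have f0 := frob2_ge0 (A - SA S12 U G J).
    apply: (@le_trans _ _ (Pnorm Sigma (A - SA S12 U G J) D ^+ 2)).
      by rewrite sqr_sqrtr ?addr_ge0// lerDr.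
    by rewrite ler_sqr ?nnegrE ?sqrtr_ge0.
  have -> : frob2 (S12 *m h) = (h^T *m (Sigma *m h)) 0 0.
    by rewrite frob2_dot trmx_mul S12T -S12S !mulmxA.
  apply: (le_trans (ler_norm _)).
  have := dot_le h (opnorm_ge0 Sigma) (frob2_le_opnorm Sigma h).
  by rewrite sO2; congr (_ <= _); field.
apply: (le_trans (lerD Ha Hb)).
have -> : eps * sO = (16^-1 - sg) / 2 by rewrite /eps; field.
rewrite -subr_ge0 (_ : _ - _ = (16^-1 - sg) * (frob2 g + frob2 h) / 4); last by field.
by rewrite divr_ge0// mulr_ge0.
Qed.

Lemma ell_bound : close_to_S ((2 * Num.sqrt (opnorm Sigma))^-1 * (16^-1 - Num.sqrt sigma))
    Sigma S12 U G V A B ->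
  forall i j (w : nat -> R), `|ell (d + p) (S12 *m B *m S12) i j w| <=
    (sqn (d + p) i w + sqn (d + p) j w) / 32.
Proof.
move=> cl i j w; have H := dot_logit_le (colv d (i * (d + p)) w) (colv d (j * (d + p)) w) cl.
have -> : ell (d + p) (S12 *m B *m S12) i j w =
    ((colv d (i * (d + p)) w)^T *m (S12 *m B *m S12) *m colv d (j * (d + p)) w) 0 0.
  rewrite [RHS]mxE; apply: eq_bigr => b _; rewrite [colv _ _ _ b _]mxE; congr (_ * _).
  by rewrite [RHS]mxE; apply: eq_bigr => a _; rewrite mulrC; congr (_ * _); rewrite !mxE.
apply: (le_trans H); rewrite ler_pM2r ?invr_gt0//.
have fs k : frob2 (colv d (k * (d + p)) w) <= sqn (d + p) k w.
  rewrite frob2_cV /sqn big_split_ord/=.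
  under eq_bigr do rewrite mxE.
  by rewrite lerDl sumr_ge0// => l _; exact: sqr_ge0.
exact: lerD.
Qed.

End logit_bound.

(** * Bias of the empirical gradient and conclusion *)

Section bias.
Context {R : realType}.
Variables (p d : nat) (S12 : 'M[R]_d) (O12 : 'M[R]_p) (M : 'M[R]_(p, d)).
Variables (A : 'M[R]_(p, d)) (B : 'M[R]_d).
Hypothesis S12T : S12^T = S12.
Local Notation q := (d + p)%N.
Local Notation K := (S12 *m B *m S12).
Hypothesis ell_le : forall i j w, `|ell q K i j w| <= (sqn q i w + sqn q j w) / 32.
Local Notation Gv := (Gv q K).
Local Notation Cov := (Cov q K).
Local Notation kap := (kap K).
Local Notation approx := (@approx R q).
Local Notation resid := (resid S12 O12 M A B).
Local Notation Nmx := (Nmx S12 O12 M).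
Local Notation C := (Cmx S12 M A B).
Let dq : (d <= q)%N := leq_addr p d.

Lemma kap_lshift (a b : 'I_d) : kap a b = K a b.
Proof.
rewrite /kap (bigD1 a)//= eqxx mulr1 big1 ?addr0// => e /negbTE ea.
by rewrite val_eqE eq_sym ea mulr0.
Qed.

Lemma kap_rshift (e : 'I_p) b : kap (d + e)%N b = 0.
Proof.
apply: big1 => a _; rewrite (_ : (_ == _) = false) ?mulr0//.
by rewrite gtn_eqF// (leq_trans (ltn_ord a))// leq_addr.
Qed.

(** The noise coordinates have limiting moment 0 with everything paired with the residual, so only
    the signal half of [Nmx] remains. *)
Lemma sum_Nmx r (f : nat -> R) : (forall e : 'I_p, f (d + e)%N = 0) ->
  \sum_(m < q) Nmx r m * f m = \sum_(c < d) (M *m S12) r c * f c.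
Proof.
move=> f0; rewrite big_split_ord/= [X in _ + X]big1 ?addr0.
  by apply: eq_bigr => c _; rewrite row_mxEl.
by move=> e _; rewrite f0 mulr0.
Qed.

Lemma CmxE : C = A *m S12 *m K^T - M *m S12.
Proof. by rewrite /Cmx !trmx_mul S12T !mulmxA. Qed.

Lemma approx_resid (f : nat -> nat -> (nat -> R) -> R) r (v1 : 'I_d -> R) (v2 : nat -> R) :
  (forall c, approx (fun n i w => Gv n i c w * f n i w) (v1 c)) ->
  (forall m, (m < q)%N -> approx (fun n i w => w (i * q + m)%N * f n i w) (v2 m)) ->
  approx (fun n i w => resid n i r w * f n i w)
    (\sum_(c < d) (A *m S12) r c * v1 c - \sum_(m < q) Nmx r m * v2 m).
Proof.
move=> h1 h2.
have a1 := approx_sum (index_enum 'I_d) (fun c => approxZ ((A *m S12) r c) (h1 c)).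
have a2 := approx_sum (index_enum 'I_q) (fun m => approxZ (Nmx r m) (h2 m (ltn_ord m))).
have := approxD a1 (approxZ (-1) a2); rewrite mulN1r; apply: approx_ext => n i w _.
rewrite /resid mulrBl mulN1r !mulr_suml; congr (_ - _).
  by apply: eq_bigr => c _; rewrite mulrA.
by apply: eq_bigr => m _; rewrite mulrA.
Qed.

(** The limits of [approx_Gv_Gv] and [approx_Gv_coord] combine to A S12 K^T K - M S12 K, and K
    factors out on the right. *)
Lemma approx_resid_Gv r f :
  approx (fun n i w => resid n i r w * Gv n i f w) ((C *m K) r f).
Proof.
apply: approx_eq (@approx_resid (fun n i w => Gv n i f w) r
  (fun c => \sum_(a < d) K a c * kap a f) (fun m => kap m f) _ _).
- rewrite (sum_Nmx r (f := fun m => kap m f)); last by move=> e; exact: kap_rshift.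
  rewrite CmxE mulmxBl [RHS]mxE [X in _ = _ + X]mxE; congr (_ - _).
    rewrite -(mulmxA (A *m S12)) [RHS]mxE; apply: eq_bigr => c _; congr (_ * _).
    by rewrite [RHS]mxE; apply: eq_bigr => a _; rewrite kap_lshift [K^T _ _]mxE.
  by rewrite [RHS]mxE; apply: eq_bigr => c _; rewrite kap_lshift.
- by move=> c; exact: approx_Gv_Gv.
- move=> m mq; apply: approx_ext (approx_Gv_coord dq ell_le f mq) => n i w _.
  by rewrite mulrC.
Qed.

Lemma approx_resid_Cov r (l h f : 'I_d) :
  approx (fun n i w => resid n i r w * (w (i * q + l)%N * Cov n i h f w))
    ((h == f)%:R * C r l).
Proof.
have lq := ordd_lt dq l.
apply: approx_eq (@approx_resid (fun n i w => w (i * q + l)%N * Cov n i h f w) r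
  (fun c => (h == f)%:R * kap l c) (fun m => (h == f)%:R * (m == l)%:R) _ _).
- rewrite (sum_Nmx r (f := fun m => (h == f)%:R * (m == l)%:R)); last first.
    by move=> e; rewrite gtn_eqF ?mulr0// (leq_trans (ltn_ord l))// leq_addr.
  rewrite CmxE [in RHS]mxE [X in _ = _ * (_ + X)]mxE mulrBr; congr (_ - _).
    rewrite [in RHS]mxE mulr_sumr; apply: eq_bigr => c _.
    by rewrite kap_lshift [K^T _ _]mxE mulrCA.
  rewrite (bigD1 l)//= eqxx mulr1 mulrC big1 ?addr0// => c /negbTE cl.
  by rewrite val_eqE cl !mulr0.
- move=> c; apply: approx_ext (approx_Gv_coord_Cov dq ell_le h f c lq) => n i w _.
  by rewrite mulrA.
- move=> m mq; apply: approx_ext (approx_coord2_Cov dq ell_le h f mq lq) => n i w _.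
  by rewrite mulrA.
Qed.

(** Uniformity in the query index carries the rate over to the mean. *)
Lemma approx_average f v : approx f v -> exists T : R, forall n, (0 < n)%N ->
  `|gint (n * q) (fun w => n%:R^-1 * \sum_(i < n) f n i w) - v| <= T / n%:R.
Proof.
move=> [nf [T T0 H]]; exists T => n n0.
have nn0 : n%:R != 0 :> R by rewrite pnatr_eq0 -lt0n.
rewrite gintZ; last by apply: nice_sum => i; exact: nf.
rewrite gint_sum; last by move=> i; exact: nf.
rewrite (_ : _ - v = n%:R^-1 * \sum_(i < n) (gint (n * q) (f n i) - v)); last first.
  by rewrite sumrB sumr_const card_ord -[v *+ n]mulr_natr mulrBr mulrCA mulVf// mulr1.
rewrite normrM ger0_norm ?invr_ge0// ler_pdivrMl ?ltr0n//.
apply: (le_trans (ler_norm_sum _ _ _)).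
apply: (@le_trans _ _ (\sum_(i < n) T / n%:R)); first by apply: ler_sum => i _; exact: H.
by rewrite sumr_const card_ord -[_ *+ n]mulr_natl.
Qed.

Lemma bias_A a b : exists T : R, forall n, (0 < n)%N ->
  `|(EgradLhatA n S12 O12 M A B - gradA (Lpop S12 O12 M) A B) a b| <= T / n%:R.
Proof.
have ap := approx_sum (index_enum 'I_d) (fun f => approxZ (S12 b f) (approx_resid_Gv a f)).
have [T HT] := approx_average ap; exists T => n n0; apply: le_trans (HT n n0).
rewrite mxE [X in _ + X]mxE [X in X - _]mxE gradA_LpopE// le_eqVlt; apply/orP; left; apply/eqP.
congr (`|_ - _|).
  apply: eq_gint => w; rewrite gradA_LhatE//; congr (_ * _); apply: eq_bigr => i _.
  by rewrite mulr_sumr; apply: eq_bigr => f _; rewrite mulrCA.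
transitivity ((C *m K *m S12^T) a b).
  rewrite -(mulmxA C) [RHS]mxE; apply: eq_bigr => c _; congr (_ * _).
  have -> : K *m S12^T = (S12 *m S12 *m B^T *m S12)^T.
    by rewrite !trmx_mul trmxK S12T !mulmxA.
  by rewrite [RHS]mxE.
by rewrite mxE; apply: eq_bigr => f _; rewrite [S12^T _ _]mxE mulrC.
Qed.

Lemma bias_B a b : exists T : R, forall n, (0 < n)%N ->
  `|(EgradLhatB n S12 O12 M A B - gradB (Lpop S12 O12 M) A B) a b| <= T / n%:R.
Proof.
have ap := approx_sum (index_enum 'I_p) (fun r => approx_sum (index_enum 'I_d) (fun l =>
  approx_sum (index_enum 'I_d) (fun h => approx_sum (index_enum 'I_d) (fun f =>
    approxZ (S12 a l * ((A *m S12) r h * S12 b f)) (approx_resid_Cov r l h f))))).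
have [T HT] := approx_average ap; exists T => n n0; apply: le_trans (HT n n0).
rewrite mxE [X in _ + X]mxE [X in X - _]mxE gradB_LpopE// le_eqVlt; apply/orP; left; apply/eqP.
congr (`|_ - _|).
  apply: eq_gint => w; rewrite gradB_LhatE//; congr (_ * _); apply: eq_bigr => i _.
  apply: eq_bigr => r _; rewrite sample_xE mulr_suml mulr_sumr; apply: eq_bigr => l _.
  rewrite !mulr_sumr; apply: eq_bigr => h _; rewrite !mulr_sumr; apply: eq_bigr => f _.
  by ring.
apply: eq_bigr => r _; apply: eq_bigr => l _.
rewrite [(A *m S12 *m S12) r b]mxE mulrCA mulr_suml; apply: eq_bigr => h _.
rewrite (bigD1 h)//= eqxx mul1r big1 ?addr0.
  by rewrite (_ : S12 b h = S12 h b); [ring|rewrite -[in LHS]S12T mxE].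
by move=> f /negbTE fh; rewrite eq_sym fh mul0r mulr0.
Qed.

End bias.

Lemma frob2_le_of_entries {R : realType} (m n : nat) (X : nat -> 'M[R]_(m, n)) :
  (forall a b, exists T : R, forall k, (0 < k)%N -> `|X k a b| <= T / k%:R) ->
  exists T : R, forall k, (0 < k)%N -> frob2 (X k) <= T * k%:R ^- 2.
Proof.
move=> H.
have H' (ab : 'I_m * 'I_n) : exists T : R, forall k, (0 < k)%N ->
    `|X k ab.1 ab.2| <= T / k%:R by exact: H.
have [T HT] := choice H'.
exists (\sum_a \sum_b T (a, b) ^+ 2) => k k0; rewrite mulr_suml; apply: ler_sum => a _.
rewrite mulr_suml; apply: ler_sum => b _.
rewrite -exprVn -exprMn -real_normK ?num_real// ler_sqr ?nnegrE//; first exact: (HT (a, b)).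
exact: le_trans (normr_ge0 _) (HT (a, b) k k0).
Qed.

(** Once the logarithm exceeds 1 + |T| it is at least 1, so its sixth power is no smaller than the
    logarithm itself. *)
Lemma ln_eventually_ge {R : realType} (T : R) : exists N : nat, forall n, (N <= n)%N ->
  (0 < n)%N /\ T <= ln (n%:R) ^+ 6.
Proof.
pose y := 1 + `|T|; exists (Num.trunc (expR y)).+1 => n Nn.
have n0 : (0 < n)%N by exact: leq_trans Nn.
split => //.
have yn : expR y <= n%:R.
  apply: (@le_trans _ _ (Num.trunc (expR y)).+1%:R); last by rewrite ler_nat.
  by apply/ltW; exact: truncnS_gt.
have yl : y <= ln n%:R by rewrite -ler_expR lnK// posrE ltr0n.
have y1 : 1 <= y by rewrite lerDl.
apply: (le_trans (ler_norm T)); apply: (@le_trans _ _ y); first by rewrite lerDr.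
apply: (le_trans yl); rewrite ler_eXnr//; exact: le_trans yl.
Qed.

Theorem theorem4 (R : realType) :
  exists (c : R) (k : nat),
  forall (p d : nat) (Sigma S12 : 'M[R]_d) (Omega O12 : 'M[R]_p)
         (M : 'M[R]_(p, d)) (U : 'M[R]_(p, d)) (G V : 'M[R]_d)
         (A : 'M[R]_(p, d)) (B : 'M[R]_d),
    (* covariances; S12 = Sigma^{1/2}, O12 = Omega^{1/2} *)
    psd Sigma -> Sigma \in unitmx ->
    psd S12 -> S12 *m S12 = Sigma ->
    psd Omega -> psd O12 -> O12 *m O12 = Omega ->
    (d <= p)%N ->
    \rank (M *m S12) = d ->
    opnorm (M *m S12) < 16^-1 ->
    (* U G V^T is an SVD of M Sigma^{1/2} *)
    U^T *m U = 1%:M -> V^T *m V = 1%:M ->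
    (forall i j, i != j -> G i j = 0) -> (forall i, 0 <= G i i) ->
    M *m S12 = U *m G *m V^T ->
    close_to_S ((2 * Num.sqrt (opnorm Sigma))^-1 *
                (16^-1 - Num.sqrt (opnorm (M *m S12))))
               Sigma S12 U G V A B ->
    exists N : nat, forall n : nat, (N <= n)%N ->
      frob2 (EgradLhatA n S12 O12 M A B - gradA (Lpop S12 O12 M) A B)
      + frob2 (EgradLhatB n S12 O12 M A B - gradB (Lpop S12 O12 M) A B)
      <= c * (1 + p%:R + d%:R + opnorm M + opnorm Sigma) ^+ k
           * ((n%:R) ^- 2 * ln (n%:R) ^+ 6).
Proof.
exists 1, 0 => p d Sigma S12 Omega O12 M U G V A B _ uSigma [S12T _] S12S _ _ _ _ _ _.
move=> UU VV Gdiag G0 svd close.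
have ell_le := ell_bound uSigma S12T S12S UU VV Gdiag G0 svd close.
have [TA HA] := frob2_le_of_entries (bias_A O12 M A S12T ell_le).
have [TB HB] := frob2_le_of_entries (bias_B O12 M A S12T ell_le).
have [N HN] := ln_eventually_ge (TA + TB); exists N => n /HN[n0 hT].
apply: (le_trans (lerD (HA n n0) (HB n n0))).
by rewrite expr0 !mul1r -mulrDl mulrC ler_wpM2l// invr_ge0 exprn_ge0.
Qed.
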